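(* Let $m\ge2$ and let $\mathbf T=(T_1,\ldots,T_m)$ be a tuple of $2\times2$ real matrices of the form $$T_i=\begin{pmatrix}0&c_i\\d_i&0\end{pmatrix},$$ where $0<|c_i|,|d_i|<1$ for $i=1,\ldots,m$. Then the following two statements are equivalent. (i) There exist distinct $i,j\in\{1,\ldots,m\}$ such that $|c_i/d_i|\ne|c_j/d_j|$. (ii) There exist an ergodic $\sigma$-invariant measure $\mu$ on $\Sigma$ and a subspace $W\in G(2,1)$ such that $\overline S(\mu,\mathbf T,W)\ne\underline S(\mu,\mathbf T,W)$.
   Context: $\Sigma=\{1,\ldots,m\}^{\mathbb N}$ with left shift $\sigma$; measures are Borel probability measures. $x|n=x_1\cdots x_n$; $[I]$ is the cylinder set of a word $I$; $T_I=T_{i_1}\cdots T_{i_n}$ for $I=i_1\cdots i_n$. $G(2,1)$ is the set of one-dimensional linear subspaces of $\mathbb R^2$; $P_W$ is the orthogonal projection onto $W$. For a real $2\times2$ matrix $A$ with singular values $\alpha_1(A)\ge\alpha_2(A)$ and $s\in[0,1]$, the singular value function is $\varphi^s(A)=\alpha_1(A)^s$. For $W\in G(2,1)$: $S_n(\mu,\mathbf T,W,x)=\sup\{s\in[0,1]\colon\varphi^s(P_WT_{x|n})\ge\mu([x|n])\}$ and $S(\mu,\mathbf T,W,x)=\lim_{n\to\infty}S_n(\mu,\mathbf T,W,x)$, which exists for $\mu$-a.e. $x$; $\underline S(\mu,\mathbf T,W)$ and $\overline S(\mu,\mathbf T,W)$ are the $\mu$-essential infimum and supremum of $x\mapsto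 S(\mu,\mathbf T,W,x)$. *)

(* Defs.v *)
From HB Require Import structures.
From mathcomp Require Import all_boot all_order all_algebra.
From mathcomp Require Import all_classical all_reals all_analysis ess_sup_inf.

Set Implicit Arguments.
Unset Strict Implicit.
Unset Printing Implicit Defensive.

Import Order.TTheory GRing.Theory Num.Theory.
Import numFieldNormedType.Exports.

Local Open Scope classical_set_scope.
Local Open Scope ring_scope.

(* One-sided full shift on m symbols, the alphabet being 'I_m = {0, ..., m-1}.
   The proof of 2 <= m is a parameter because [measurableType] inherits from
   [pointedType], and nat -> 'I_m has no point when m = 0. *)
Definition shift_space (m : nat) (hm : (2 <= m)%N) : Type :=
  prod_topology (fun _ : nat => discrete_topology 'I_m).

HB.instance Definition _ m hm := Topological.on (@shift_space m hm).
HB.instance Definition _ m hm :=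
  isPointed.Build (@shift_space m hm) (fun=> Ordinal (ltnW hm)).

Definition borel (T : ptopologicalType) := g_sigma_algebraType (@open T).

Definition shift_map m hm (x : @shift_space m hm) : @shift_space m hm :=
  fun n => x n.+1.

(* x|n *)
Definition prefix_word m hm (x : @shift_space m hm) (n : nat) : seq 'I_m :=
  mkseq x n.

Definition cylinder m hm (I : seq 'I_m) : set (@shift_space m hm) :=
  [set x | prefix_word x (size I) = I].
Arguments cylinder {m} hm I.

Section measure_preserving.
Context d (X : measurableType d) (R : realType).
Implicit Types (mu : probability X R) (f : X -> X).

Definition invariant_measure mu f : Prop :=
  forall A : set X, measurable A -> mu (f @^-1` A) = mu A.

Definition ergodic_measure mu f : Prop :=
  invariant_measure mu f /\
  forall A : set X, measurable A -> f @^-1` A = A ->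
    mu A = 0%:E \/ mu A = 1%:E.

End measure_preserving.

Section linear_algebra.
Context {R : realType}.
Implicit Types (A P : 'M[R]_2) (W : {vspace 'cV[R]_2}).

Definition antidiag_mx (c d : R) : 'M[R]_2 :=
  \matrix_(i < 2, j < 2)
    if i == j then 0 else if i == 0 :> nat then c else d.

Definition singular_value A : set R :=
  [set a | 0 <= a /\ eigenvalue (A^T *m A) (a ^+ 2)].

(* A sup over a nonempty set of at most two elements, hence a maximum. *)
Definition alpha1 A : R := sup (singular_value A).

(* phi^s for 0 <= s <= 1 only. *)
Definition phi (s : R) A : R := alpha1 A `^ s.

Definition word_mx m (T : 'I_m -> 'M[R]_2) (I : seq 'I_m) : 'M[R]_2 :=
  \prod_(i <- I) T i.

Definition is_orthoproj W P : Prop :=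
  forall v : 'cV[R]_2, P *m v \in W /\
    forall w, w \in W -> w^T *m (v - P *m v) = 0.

(* Matrix of the orthogonal projection onto W, acting on column vectors. *)
Definition orthoproj W : 'M[R]_2 := xget 0 [set P | is_orthoproj W P].

Lemma is_orthoproj_uniq W P Q : is_orthoproj W P -> is_orthoproj W Q -> P = Q.
Proof.
move=> hP hQ; apply: subr0_eq; set D := P - Q.
have Dv (v : 'cV[R]_2) : D *m v = 0.
  have [Pv Pvo] := hP v; have [Qv Qvo] := hQ v.
  have DW : D *m v \in W by rewrite mulmxBl rpredB.
  have DvE : D *m v = (v - Q *m v) - (v - P *m v).
    by rewrite mulmxBl opprB [RHS]addrC addrA subrK.
  have : (D *m v)^T *m (D *m v) = 0.
    by rewrite [X in _ *m X]DvE mulmxBr Qvo // Pvo // subrr.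
  move=> /matrixP /(_ 0 0); rewrite !mxE => Dv0.
  apply/matrixP => i j; rewrite ord1 [RHS]mxE.
  have Dv_ge0 k : true -> 0 <= (D *m v)^T 0 k * (D *m v) k 0.
    by rewrite [_^T _ _]mxE -expr2 sqr_ge0.
  have := psumr_eq0P Dv_ge0 Dv0 (i := i) isT.
  by rewrite [_^T _ _]mxE => /eqP; rewrite mulf_eq0 orbb => /eqP.
by apply/matrixP => i j; have := Dv (delta_mx j 0);
  rewrite -colE => /matrixP/(_ i 0); rewrite !mxE.
Qed.

Lemma orthoprojP W : \dim W = 1%N -> is_orthoproj W (orthoproj W).
Proof.
move=> dimW; apply: (xgetPex 0).
have Wn0 : W != 0%VS by rewrite -dimv_eq0 dimW.
set u := vpick W; have uW : u \in W := memv_pick W.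
have un0 : u != 0 by rewrite vpick0.
have WE : W = <[u]>%VS.
  by apply/esym/eqP; rewrite eqEdim -memvE uW dimW dim_vline un0.
have [q qE] : exists q, u^T *m u = q%:M.
  by exists ((u^T *m u) 0 0); rewrite [LHS]mx11_scalar.
have qn0 : q != 0.
  apply: contra_neq un0 => q0; apply/matrixP => i j; rewrite ord1 [RHS]mxE.
  have : (u^T *m u) 0 0 = 0 by rewrite qE q0 !mxE.
  rewrite mxE => uu0.
  have u_ge0 k : true -> 0 <= u^T 0 k * u k 0.
    by rewrite [_^T _ _]mxE -expr2 sqr_ge0.
  have := psumr_eq0P u_ge0 uu0 (i := i) isT.
  by rewrite [_^T _ _]mxE => /eqP; rewrite mulf_eq0 orbb => /eqP.
exists (q^-1 *: (u *m u^T)) => v.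
have Pv : q^-1 *: (u *m u^T) *m v = (q^-1 * (u^T *m v) 0 0) *: u.
  by rewrite -scalemxAl -mulmxA [u^T *m v]mx11_scalar mul_mx_scalar scalerA
    !mxE mulr1n.
split=> [|w]; first by rewrite Pv rpredZ.
rewrite WE => /vlineP[k ->].
rewrite linearZ /= -scalemxAl mulmxBr Pv -scalemxAr qE.
rewrite [u^T *m v]mx11_scalar scale_scalar_mx mulrAC mulVf // mul1r.
by rewrite !mxE mulr1n subrr scaler0.
Qed.

End linear_algebra.

Section local_dimension.
Context {R : realType} {m : nat} {hm : (2 <= m)%N}.
Implicit Types (mu : probability (borel (shift_space hm)) R)
  (T : 'I_m -> 'M[R]_2) (W : {vspace 'cV[R]_2}) (x : shift_space hm).

Definition S_n mu T W x (n : nat) : R :=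
  sup [set s : R | 0 <= s <= 1 /\
    (mu (cylinder hm (prefix_word x n)) <=
      (phi s (orthoproj W *m word_mx T (prefix_word x n)))%:E)%E].

(* [lim] returns a default value where the limit does not exist; in the setting
   of the theorem this happens only on a mu-null set, which the essential bounds
   below ignore. *)
Definition S_lim mu T W x : R := limn (S_n mu T W x).

Definition S_upper mu T W : \bar R := ess_sup mu (EFin \o S_lim mu T W).

Definition S_lower mu T W : \bar R := ess_inf mu (EFin \o S_lim mu T W).

End local_dimension.

(* Main.v *)
Require Import Defs.
From HB Require Import structures.
From mathcomp Require Import all_boot all_order all_algebra.
From mathcomp Require Import all_classical all_reals all_analysis ess_sup_inf.
From mathcomp Require Import measurable_realfun.
From mathcomp Require Import ring lra zify.

(** Each [T_i] exchanges the two axes, so the rows of a product [T_I] are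
    orthogonal, and their norms are the alternating products [|c| |d| |c| ...]
    and [|d| |c| |d| ...] of the entries along [I] ([altprod]). The norm of
    [P_W T_I] is a quadratic mean of these two with weights given by the angle
    of [W] ([alpha1_proj_word]), and [S_n] is the ratio of [- ln mu [x|n]] to
    [- ln |P_W T_(x|n)|], clipped at 1.

    Suppose that [|c_i / d_i|] is constant and [mu] is ergodic. The two products
    then agree up to a bounded factor, so prepending a letter to a word changes
    the logarithm of its projected norm by a bounded amount
    ([ln_projnorm_cons]). It does not increase the measure of the cylinder, by
    invariance, and almost surely it decreases it by a subexponential factor
    only, by Borel-Cantelli ([ae_cylinder_cons]). Hence
    [S_(n+1)(x) - S_n(sigma x)] tends to 0 almost surely. The upper and lower
    limits of [S_n] are thus almost invariant functions, which ergodicity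
    forces to be constant, and the essential bounds coincide
    ([S_upper_lower_eq]).

    If [|c_i / d_i|] and [|c_j / d_j|] differ, take for [W] the first axis and
    for [mu] a measure that remembers parity. Concatenate independent fair
    choices between two words of the same even length [N] that have the same
    first alternating product [Q] and the same second one [Q'], where [Q] and
    [Q'] are different ([exists_words]), and average the law over the [N]
    shifts. Cylinder measures decay like [2^(-n/N)], whatever the shift
    ([info_average]), but norms decay like [Q^(n/N)] along a concatenation and
    like [Q'^(n/N)] along its first shift ([ln_altprod_decodable],
    [ln_altprod_shift_decodable]). So [S] takes the two values
    [ln 2 / - ln Q] and [ln 2 / - ln Q'] on sets of positive measure. The
    average is nevertheless ergodic: the law of the concatenation is
    self-similar, which makes every invariant set independent of all cylinders
    ([self_similar_01]). *)

Import Order.TTheory GRing.Theory Num.Theory.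
Import numFieldNormedType.Exports.

Local Open Scope classical_set_scope.
Local Open Scope ring_scope.

(** * Norms of projected products of antidiagonal matrices *)

Section projected_products.
Context {R : realType}.

Definition normsq (v : 'cV[R]_2) : R := v 0 0 ^+ 2 + v 1 0 ^+ 2.

Lemma ord2 (i : 'I_2) : i = 0 \/ i = 1.
Proof. by case: i => -[|[|//]] hi; [left|right]; apply/val_inj. Qed.

Lemma normsq_gt0 (v : 'cV[R]_2) : v != 0 -> 0 < normsq v.
Proof.
move=> v0; rewrite /normsq lt0r addr_ge0 ?sqr_ge0 // andbT.
apply: contra_neq v0 => /eqP; rewrite paddr_eq0 ?sqr_ge0 // !sqrf_eq0.
move=> /andP[/eqP a /eqP b]; apply/matrixP => i j; rewrite ord1 mxE.
by case: (ord2 i) => ->.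
Qed.

Lemma normsqE (v : 'cV[R]_2) : v^T *m v = (normsq v)%:M.
Proof.
rewrite [LHS]mx11_scalar; congr (_%:M).
by rewrite mxE big_ord_recl big_ord1 !mxE /= /normsq !expr2;
  congr (_ + v _ _ * v _ _); apply/val_inj.
Qed.

Lemma orthoproj_line (u : 'cV[R]_2) : u != 0 ->
  orthoproj <[u]>%VS = (normsq u)^-1 *: (u *m u^T).
Proof.
move=> u0; have q0 := normsq_gt0 _ u0.
apply: is_orthoproj_uniq; first by apply: orthoprojP; rewrite dim_vline u0.
move=> v.
have Pv : (normsq u)^-1 *: (u *m u^T) *m v
    = ((normsq u)^-1 * (u^T *m v) 0 0) *: u.
  by rewrite -scalemxAl -mulmxA [u^T *m v]mx11_scalar mul_mx_scalar scalerA
    !mxE mulr1n.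
split=> [|w]; first by rewrite Pv memvZ // memv_line.
move=> /vlineP[k ->]; rewrite linearZ /= -scalemxAl mulmxBr Pv -scalemxAr.
rewrite normsqE scale_scalar_mx mulrAC mulVf ?gt_eqF // mul1r.
by rewrite -mx11_scalar subrr scaler0.
Qed.

(** A Gram matrix proportional to [v v^T] has [k |v|^2] as its only nonzero
    eigenvalue: pairing an eigenvector [w] with [v] shows that either [w]
    is orthogonal to [v], and the eigenvalue is zero, or it is [k |v|^2]. *)
Lemma alpha1_rank1 (A : 'M[R]_2) (v : 'cV[R]_2) (k : R) : 0 < k -> v != 0 ->
  A^T *m A = k *: (v *m v^T) -> alpha1 A = Num.sqrt (k * normsq v).
Proof.
move=> k0 v0 E; have q0 := normsq_gt0 _ v0.
have kq : 0 <= k * normsq v by rewrite mulr_ge0 // ltW.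
have mem : singular_value A (Num.sqrt (k * normsq v)).
  split; first exact: sqrtr_ge0.
  rewrite sqr_sqrtr // E; apply/eigenvalueP; exists v^T.
    by rewrite -scalemxAr mulmxA normsqE mul_scalar_mx scalerA.
  by apply: contra_neq v0 => h; rewrite -[v]trmxK h trmx0.
have ub : ubound (singular_value A) (Num.sqrt (k * normsq v)).
  move=> a [a0]; rewrite E => /eigenvalueP[w wE w0].
  have wE' : (k * (w *m v) 0 0) *: v^T = a ^+ 2 *: w.
    rewrite -wE -scalemxAr mulmxA [w *m v]mx11_scalar mul_scalar_mx scalerA.
    by congr (_ * _ *: _); rewrite mxE eqxx mulr1n.
  have [wv|wv] := eqVneq ((w *m v) 0 0) 0.
    move: wE'; rewrite wv mulr0 scale0r => /esym/eqP.
    rewrite scaler_eq0 (negbTE w0) orbF sqrf_eq0 => /eqP ->; exact: sqrtr_ge0.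
  have := congr1 (fun z => (z *m v) 0 0) wE'.
  have Z b (B : 'M[R]_1) : (b *: B) 0 0 = b * B 0 0 by rewrite mxE.
  rewrite /= -!scalemxAl normsqE !Z [_%:M _ _]mxE eqxx mulr1n => h.
  have -> : k * normsq v = a ^+ 2.
    by apply: (mulIf wv); rewrite -h mulrAC.
  by rewrite sqrtr_sqr ger0_norm.
apply/eqP; rewrite eq_le; apply/andP; split.
  by apply: ge_sup => //; exists (Num.sqrt (k * normsq v)).
by apply: ub_le_sup => //; exists (Num.sqrt (k * normsq v)).
Qed.

(** [altprod c d I] and [altprod d c I] are the absolute values of the two
    nonzero entries of [T_I]: each antidiagonal factor swaps the axes, so the
    letters contribute alternately through [c] and [d]. *)
Fixpoint altprod {m} (c d : 'I_m -> R) (I : seq 'I_m) : R :=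
  if I is i :: J then `|c i| * altprod d c J else 1.

Lemma altprod_gt0 {m} (c d : 'I_m -> R) (I : seq 'I_m) :
  (forall i, 0 < `|c i|) -> (forall i, 0 < `|d i|) -> 0 < altprod c d I.
Proof. by elim: I c d => //= i I IH c d hc hd; rewrite mulr_gt0 // IH. Qed.

Lemma altprod_cat {m} (c d : 'I_m -> R) (I J : seq 'I_m) :
  altprod c d (I ++ J) = altprod c d I *
    (if odd (size I) then altprod d c J else altprod c d J).
Proof.
elim: I c d => [|i I IH] c d /=; first by rewrite mul1r.
by rewrite IH -mulrA; case: (odd (size I)).
Qed.

Lemma normsq_word_mx {m} (c d : 'I_m -> R) (I : seq 'I_m) (u : 'cV[R]_2) :
  normsq ((word_mx (fun i => antidiag_mx (c i) (d i)) I)^T *m u)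
  = u 0 0 ^+ 2 * altprod c d I ^+ 2 + u 1 0 ^+ 2 * altprod d c I ^+ 2.
Proof.
elim: I u => [|i I IH] u; rewrite /word_mx.
  by rewrite big_nil trmx1 mul1mx /= !expr1n !mulr1.
rewrite big_cons -mulmxE trmx_mul -mulmxA [LHS]IH /=.
have e0 : ((antidiag_mx (c i) (d i))^T *m u) 0 0 = d i * u 1 0.
  rewrite mxE big_ord_recl big_ord1 !mxE /= mul0r add0r.
  by congr (_ * u _ _); apply/val_inj.
have e1 : ((antidiag_mx (c i) (d i))^T *m u) 1 0 = c i * u 0 0.
  by rewrite mxE big_ord_recl big_ord1 !mxE /= mul0r addr0.
rewrite e0 e1 !exprMn !real_normK ?num_real //; ring.
Qed.

(** [W] enters only through the squared cosine [p] of its angle with the first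
    axis: the rows of [T_I] are orthogonal, and their norms are the two
    alternating products. *)
Lemma alpha1_proj_word {m} (c d : 'I_m -> R) (u : 'cV[R]_2) (I : seq 'I_m) :
  u != 0 -> (forall i, 0 < `|c i|) -> (forall i, 0 < `|d i|) ->
  alpha1 (orthoproj <[u]>%VS *m word_mx (fun i => antidiag_mx (c i) (d i)) I)
  = Num.sqrt (u 0 0 ^+ 2 / normsq u * altprod c d I ^+ 2
     + (1 - u 0 0 ^+ 2 / normsq u) * altprod d c I ^+ 2).
Proof.
move=> u0 hc hd; have q0 := normsq_gt0 _ u0.
set M := word_mx _ _.
have nMu := normsq_word_mx c d I u; rewrite -/M in nMu.
have Mu_gt0 : 0 < normsq (M^T *m u).
  have a := altprod_gt0 c d I hc hd; have b := altprod_gt0 d c I hd hc.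
  rewrite nMu; have [h0|h] := eqVneq (u 0 0) 0.
    have := q0; rewrite /normsq h0 expr0n mul0r !add0r => u1.
    by apply: mulr_gt0 => //; rewrite exprn_gt0.
  apply: ltr_pwDl; last by rewrite mulr_ge0 ?sqr_ge0.
  apply: mulr_gt0; last by rewrite exprn_gt0.
  by rewrite lt0r sqr_ge0 sqrf_eq0 h.
rewrite (alpha1_rank1 _ (M^T *m u) (normsq u)^-1) ?invr_gt0 //.
- congr Num.sqrt; rewrite nMu.
  have -> : 1 - u 0 0 ^+ 2 / normsq u = u 1 0 ^+ 2 / normsq u.
    by apply: (mulIf (lt0r_neq0 q0)); rewrite mulrBl !divfK ?gt_eqF //
      /normsq; ring.
  field; exact: lt0r_neq0.
- apply: contraTneq Mu_gt0 => ->.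
  by rewrite /normsq !mxE expr0n addr0 ltxx.
rewrite orthoproj_line // trmx_mul linearZ /= trmx_mul trmxK.
rewrite -!(scalemxAl, scalemxAr) scalerA trmx_mul trmxK !mulmxA.
rewrite -[M^T *m u *m u^T *m u]mulmxA normsqE mul_mx_scalar -!scalemxAl scalerA.
by rewrite -mulrA mulVf ?mulr1 // lt0r_neq0.
Qed.

End projected_products.

(** * Local exponents as ratios of logarithms *)

Section exponents.
Context {R : realType}.
Implicit Types a l p : R.

Definition clipped_ratio a l : R := Num.min 1 (a / l).

Lemma clipped_ratioE a l : 0 < l -> clipped_ratio a l = Num.min l a / l.
Proof.
by move=> l0; rewrite /clipped_ratio minr_pMl ?divff ?gt_eqF // invr_ge0 ltW.
Qed.

(** The exponents [s] form the interval from 0 to the solution of [a^s = p],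
    cut at 1. *)
Lemma sup_exponent a p : 0 < a < 1 -> 0 < p <= 1 ->
  sup [set s : R | 0 <= s <= 1 /\ (p%:E <= (a `^ s)%:E)%E]
  = clipped_ratio (- ln p) (- ln a).
Proof.
move=> /andP[a0 a1] /andP[p0 p1].
have la : ln a < 0 by rewrite ln_lt0 // a0.
have lp : ln p <= 0 by rewrite ln_le0.
have r0 : 0 <= - ln p / - ln a by rewrite divr_ge0 // oppr_ge0 // ltW.
suff -> : [set s : R | 0 <= s <= 1 /\ (p%:E <= (a `^ s)%:E)%E]
    = `[0, clipped_ratio (- ln p) (- ln a)]%classic.
  by rewrite sup_itv ?bnd_simp // le_min ler01.
apply/seteqP; split => s /=; rewrite in_itv /= lee_fin le_min.
  case=> /andP[s0 s1] h; rewrite s0 s1 /= ler_pdivlMr ?oppr_gt0 //.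
  rewrite mulrN lerN2 -ln_powR ler_ln ?posrE ?powR_gt0 //.
case/and3P => s0 s1; rewrite ler_pdivlMr ?oppr_gt0 // mulrN lerN2 -ln_powR => h.
by rewrite s0 s1; split=> //; rewrite -ler_ln ?posrE ?powR_gt0.
Qed.

(** Clipping is what makes this estimate uniform: the numerator never exceeds
    the denominator, so the error is governed by the denominator alone. *)
Lemma dist_clipped_ratio (a l a' l' e : R) : 0 < l -> 0 < l' -> 0 <= a' ->
  `|a - a'| <= e -> `|l - l'| <= e ->
  `|clipped_ratio a l - clipped_ratio a' l'| <= 2 * e / l.
Proof.
move=> l0 l'0 a'0 ha hl; rewrite !clipped_ratioE //.
set x := Num.min l a; set y := Num.min l' a'.
have hxy : `|x - y| <= e.
  move: ha hl; rewrite /x /y !minEle !ler_norml => /andP[? ?] /andP[? ?].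
  by case: (leP l a) => ?; case: (leP l' a') => ?; apply/andP; split; lra.
have y0 : 0 <= y by rewrite le_min a'0 ltW.
have yl : y / l' <= 1 by rewrite ler_pdivrMr // mul1r ge_min lexx.
have -> : x / l - y / l' = ((x - y) + (y / l') * (l' - l)) / l.
  by field; rewrite !gt_eqF.
rewrite normrM normfV (gtr0_norm l0) ler_wpM2r ?invr_ge0 ?(ltW l0) //.
apply: le_trans (ler_normD _ _) _; rewrite [2 * e]mulr_natl mulr2n lerD //.
rewrite normrM ger0_norm ?divr_ge0 ?(ltW l'0) // distrC.
by rewrite (le_trans _ hl) // ler_piMl.
Qed.

(** Bounded errors do not matter when both quantities grow linearly. *)
Lemma cvg_clipped_ratio (a l : nat -> R) (h b C : R) :
  0 <= h -> h < b ->
  (forall n, `|a n - n%:R * h| <= C) -> (forall n, `|l n - n%:R * b| <= C) ->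
  clipped_ratio (a n) (l n) @[n --> \oo] --> h / b.
Proof.
move=> h0 hb Ha Hl; have b0 : 0 < b by exact: le_lt_trans hb.
have C0 : 0 <= C by exact: le_trans (Ha 0).
have lim0 (K : R) : K / n%:R @[n --> \oo] --> (0 : R).
  rewrite -[X in _ --> X](mulr0 K); apply: cvgMl_tmp.
  apply/gtr0_cvgV0; last exact: cvgr_idn.
  by exists 1%N => // n /= n0; rewrite ltr0n.
apply/cvgrPdist_lt => e e0.
have c0 := lim0 (2 * C * 2 / b).
move/cvgr0Pnorm_lt/(_ _ e0) : (c0) => ev1.
have ev2 : \forall n \near \oo, C / n%:R < b / 2.
  by apply: (cvgr_lt 0) (lim0 C) _ _; rewrite divr_gt0.
near=> n.
have n0 : 0 < n%:R :> R by rewrite ltr0n; near: n; exists 1%N.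
have hC : C < n%:R * (b / 2).
  by rewrite -ltr_pdivrMl // mulrC; near: n.
have ln : n%:R * (b / 2) < l n.
  by have := Hl n; rewrite ler_norml => /andP[]; lra.
have l0 : 0 < l n by apply: lt_trans ln; rewrite mulr_gt0 // divr_gt0.
have -> : h / b = clipped_ratio (n%:R * h) (n%:R * b).
  rewrite /clipped_ratio -mulf_div divff ?gt_eqF // mul1r.
  by rewrite min_r // ler_pdivrMr // mul1r ltW.
rewrite distrC.
apply: le_lt_trans (dist_clipped_ratio _ _ _ _ C l0 _ _ (Ha n) (Hl n)) _.
- by rewrite mulr_gt0.
- by rewrite mulr_ge0.
have : `|2 * C * 2 / b / n%:R| < e by near: n.
rewrite ger0_norm; last by rewrite !mulr_ge0 ?invr_ge0 // ltW.
apply: le_lt_trans.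
rewrite ler_pdivrMr //.
have -> : 2 * C * 2 / b / n%:R * l n = 2 * C * (l n / (n%:R * (b / 2))).
  by field; rewrite !gt_eqF.
rewrite ler_peMr ?mulr_ge0 // ler_pdivlMr ?mul1r ?ltW //.
by rewrite mulr_gt0 // divr_gt0.
Unshelve. all: by end_near. Qed.

(** The numerators may differ by any sublinear amount, since the denominators
    grow at least linearly. *)
Lemma cvg_clipped_ratio_sub (a l a' l' : nat -> R) (b C : R) : 0 < b ->
  (forall n, (0 < n)%N -> [/\ n%:R * b <= l n, 0 < l' n, 0 <= a' n &
     `|l n - l' n| <= C]) ->
  (forall e, 0 < e -> \forall n \near \oo, `|a n - a' n| <= n%:R * e) ->
  clipped_ratio (a n) (l n) - clipped_ratio (a' n) (l' n) @[n --> \oo] --> 0.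
Proof.
move=> b0 H Ha; apply/cvgr0Pnorm_lt => e e0.
have C0 : 0 <= C by have [_ _ _] := H 1%N isT; exact: le_trans.
have eb : 0 < e * b / 6 by rewrite !mulr_gt0 // invr_gt0.
have ev1 := Ha _ eb.
near=> n.
have n0 : (0 < n)%N by near: n; exists 1%N.
have [hl l'0 a'0 hC] := H n n0.
have nR : 0 < n%:R :> R by rewrite ltr0n.
have l0 : 0 < l n by apply: lt_le_trans hl; rewrite mulr_gt0.
have h1 : `|a n - a' n| <= n%:R * (e * b / 6) by near: n.
have h2 : C <= n%:R * (e * b / 6).
  rewrite -ler_pdivrMr // ltW //; near: n; exact: nbhs_infty_gtr.
apply: le_lt_trans (dist_clipped_ratio _ _ _ _ _ l0 l'0 a'0 h1
  (le_trans hC h2)) _.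
rewrite ltr_pdivrMr //.
have : e * (n%:R * b) <= e * l n by rewrite ler_wpM2l // ltW.
apply: lt_le_trans.
have : 0 < e * (n%:R * b) by rewrite !mulr_gt0.
lra.
Unshelve. all: by end_near. Qed.

End exponents.

(** * Cylinders generate the Borel sets of the shift space *)

Section cylinders.
Context {m : nat} {hm : (2 <= m)%N}.
Notation X := (shift_space hm).
Implicit Types (x y : X) (I J : seq 'I_m).

Lemma prefix_word_cylinder x n : cylinder hm (prefix_word x n) x.
Proof. by rewrite /cylinder /= size_mkseq. Qed.

Lemma cylinderP I x (i0 : 'I_m) :
  cylinder hm I x <-> forall k, (k < size I)%N -> x k = nth i0 I k.
Proof.
split=> [<- k|h]; first by rewrite size_mkseq => hk; rewrite nth_mkseq.
rewrite /cylinder /=; apply: (@eq_from_nth _ i0); rewrite size_mkseq // => k hk.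
by rewrite nth_mkseq // h.
Qed.

Lemma prefix_word_eq x y n :
  prefix_word x n = prefix_word y n <-> forall k, (k < n)%N -> x k = y k.
Proof.
split=> [h k hk|h]; last first.
  by apply/eq_in_map => k; rewrite mem_iota add0n => /h.
by have := congr1 (fun s => nth (x 0%N) s k) h; rewrite /= !nth_mkseq.
Qed.

Lemma open_coordinate k (a : 'I_m) : open [set x : X | x k = a].
Proof.
have := @open_comp X (discrete_topology 'I_m) (proj k) [set a].
apply.
  by move=> x _; exact: proj_continuous.
exact: discrete_open.
Qed.

Lemma measurable_cylinder I : measurable (cylinder hm I : set (borel X)).
Proof.
pose i0 : 'I_m := Ordinal (ltnW hm).
have -> : cylinder hm I
    = \bigcap_(k in [set k | (k < size I)%N]) [set x | x k = nth i0 I k].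
  by apply/seteqP; split => x; rewrite (cylinderP _ _ i0).
apply: bigcap_measurableType => k _.
apply: sub_sigma_algebra; exact: open_coordinate.
Qed.

(** Otherwise every prefix of [x] extends to a point outside [U], and these
    points converge to [x]. *)
Lemma open_cylinder_nbhs (U : set X) x : open U -> U x ->
  exists n, cylinder hm (prefix_word x n) `<=` U.
Proof.
move=> oU Ux; apply: contrapT => /forallNP h.
have /choice[g hg] : forall n, exists y,
    cylinder hm (prefix_word x n) y /\ ~ U y.
  by move=> n; have /existsNP[y /not_implyP] := h n; exists y.
have gcvg : g @ \oo --> x.
  apply/cvg_sup => N V [W [[Z] oZ <-] Zx ZV].
  apply: (filterS ZV); rewrite nbhs_simpl; exists N.+1 => // i /= Ni.
  have [/(cylinderP _ _ (x 0%N)) + _] := hg i.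
  by rewrite size_mkseq => /(_ N Ni) ->; rewrite nth_mkseq.
have := gcvg U (open_nbhs_nbhs (conj oU Ux)).
rewrite nbhs_simpl => -[N _ /(_ N (leqnn N))] /=.
by have [] := hg N.
Qed.

Lemma borel_cylinders :
  @measurable _ (borel X) = <<s range (@cylinder m hm) >>.
Proof.
apply/seteqP; split; last first.
  apply: smallest_sub; first exact: sigma_algebra_measurable.
  by move=> _ [I _ <-]; exact: measurable_cylinder.
apply: smallest_sub; first exact: smallest_sigma_algebra.
move=> U oU.
pose F I := if `[< cylinder hm I `<=` U >] then cylinder hm I else set0.
have -> : U = \bigcup_I F I.
  apply/seteqP; split => [x Ux|x [I _]]; rewrite /F; last first.
    by case: asboolP => // h /h.
  have [n hn] := open_cylinder_nbhs U x oU Ux.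
  exists (prefix_word (x : X) n) => //; case: asboolP => // _.
  exact: prefix_word_cylinder.
apply: (@countable_bigcupT_measurable _
  (g_sigma_algebraType (range (@cylinder m hm)))); first exact: countableP.
move=> I; rewrite /F; case: asboolP => _; last exact: measurable0.
by apply: sub_sigma_algebra; exists I.
Qed.

Lemma cylinder_nil : cylinder hm [::] = setT.
Proof. by apply/seteqP; split. Qed.

Lemma cylinder_subset I J x : (size I <= size J)%N ->
  cylinder hm I x -> cylinder hm J x -> cylinder hm J `<=` cylinder hm I.
Proof.
move=> sIJ; rewrite /cylinder /= => hI hJ y hy.
apply: etrans hI; apply/prefix_word_eq => k hk.
have /prefix_word_eq := etrans hy (esym hJ); apply.
exact: leq_trans hk sIJ.
Qed.

(** The empty set makes the family stable under intersection. *)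
Let cylinders0 : set (set (borel X)) := [set set0] `|` range (@cylinder m hm).

Lemma setI_closed_cylinders : setI_closed cylinders0.
Proof.
move=> _ _ [->|[I _ <-]] [->|[J _ <-]]; rewrite ?set0I ?setI0; do 3?by left.
have [->|/set0P[x [xI xJ]]] := eqVneq (cylinder hm I `&` cylinder hm J) set0.
  by left.
have [sIJ|/ltnW sJI] := leqP (size I) (size J).
  by rewrite setIidr; [right; exists J|exact: cylinder_subset xI xJ].
by rewrite setIidl; [right; exists I|exact: cylinder_subset xJ xI].
Qed.

Lemma borel_cylinders0 : @measurable _ (borel X) = <<s cylinders0 >>.
Proof.
apply/seteqP; split.
  rewrite borel_cylinders; apply: smallest_sub.
    exact: smallest_sigma_algebra.
  by move=> A hA; apply: sub_sigma_algebra; right.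
apply: smallest_sub; first exact: sigma_algebra_measurable.
move=> A [->|[I _ <-]]; [exact: measurable0|exact: measurable_cylinder].
Qed.

Lemma measurable_fun_cylinders d (Y : measurableType d) (f : Y -> borel X) :
  (forall I, measurable (f @^-1` cylinder hm I)) -> measurable_fun setT f.
Proof.
move=> h; apply: (@measurability _ _ _ (borel X) _ _ (range (@cylinder m hm))).
  exact: borel_cylinders.
by move=> _ [_ [I _ <-] <-]; rewrite setTI.
Qed.

Lemma measure_eq_cylinders {R : realType}
    (mu nu : {measure set (borel X) -> \bar R}) : (mu setT < +oo)%E ->
  (forall I, mu (cylinder hm I) = nu (cylinder hm I)) ->
  forall A, measurable A -> mu A = nu A.
Proof.
move=> fmu h; apply: (measure_unique cylinders0 (fun=> setT)).
- exact: borel_cylinders0.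
- exact: setI_closed_cylinders.
- by move=> _; right; exists [::] => //; exact: cylinder_nil.
- by rewrite bigcup_const.
- by move=> A [->|[I _ <-]]; [rewrite !measure0|exact: h].
- by [].
Qed.

Lemma shift_map_cylinder I :
  @shift_map m hm @^-1` cylinder hm I = \bigcup_i cylinder hm (i :: I).
Proof.
apply/seteqP; split=> [x|x [i _]] /=.
  move=> h; exists (x 0%N) => //; apply/(cylinderP _ _ (x 0%N)).
  case=> // k /= hk; move: h => /(cylinderP _ _ (x 0%N)); exact.
move=> /(cylinderP _ _ i) h; apply/(cylinderP _ _ i) => k hk.
by have := h k.+1 hk.
Qed.

Lemma measurable_shift_map :
  measurable_fun setT (@shift_map m hm : borel X -> borel X).
Proof.
apply: measurable_fun_cylinders => I; rewrite shift_map_cylinder.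
apply: countable_bigcupT_measurable; first exact: countableP.
by move=> i; exact: measurable_cylinder.
Qed.

End cylinders.

(** * Almost invariant functions and ergodicity *)

Section upper_limits.
Context {R : realType}.
Implicit Types (u v : nat -> R) (a b : R).

Let cvg_limn_sup u : bounded_fun u -> sups u @ \oo --> limn_sup u.
Proof.
move=> bu; rewrite limn_supE //; apply: cvg_sups_inf.
  exact: bounded_fun_has_ubound.
exact: bounded_fun_has_lbound.
Qed.

Lemma le_limn_sup u v : bounded_fun u -> bounded_fun v ->
  (forall e, 0 < e -> \forall n \near \oo, u n <= v n + e) ->
  limn_sup u <= limn_sup v.
Proof.
move=> bu bv uv; apply/ler_addgt0Pr => e e0.
have cu := cvg_limn_sup u bu; have cv := cvg_limn_sup v bv.
have ce : sups v n + e @[n --> \oo] --> limn_sup v + e.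
  by apply: cvgD cv _; exact: cvg_cst.
apply: (ler_cvg_to cu ce).
have [N _ hN] := uv e e0; exists N => // n /= Nn.
apply: ge_sup; first by exists (u n); exists n => /=.
move=> _ [k /= nk <-]; apply: le_trans (hN k (leq_trans Nn nk)) _.
rewrite lerD2r; apply: ub_le_sup; last by exists k.
exact/has_ubound_sdrop/bounded_fun_has_ubound.
Qed.

Lemma limn_sup_shift u : bounded_fun u ->
  limn_sup (fun n => u n.+1) = limn_sup u.
Proof.
move=> bu; apply/cvg_lim => //.
have -> : sups (fun n => u n.+1) = (fun n => sups u n.+1).
  apply/funext => n; congr sup; apply/seteqP; split => _ [k /= hk <-].
    by exists k.+1.
  by case: k hk => // k hk; exists k.
by rewrite (cvg_shiftS (sups u) (nbhs (limn_sup u))); exact: cvg_limn_sup.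
Qed.

Lemma limn_sup_cvg0 u v : bounded_fun u -> bounded_fun v ->
  u n - v n @[n --> \oo] --> 0 -> limn_sup u = limn_sup v.
Proof.
move=> bu bv uv; apply/le_anti/andP; split; apply: le_limn_sup => // e e0.
  move/cvgr0Pnorm_lt/(_ _ e0): uv; apply: filterS => n.
  by rewrite ltr_norml => /andP[_ h]; rewrite -lerBlDl ltW.
move/cvgr0Pnorm_lt/(_ _ e0): uv; apply: filterS => n.
by rewrite ltr_norml => /andP[+ _]; lra.
Qed.

(** The limit, including its default value [point] in case of divergence, is a
    function of the upper and lower limits. So if these two are almost surely
    constant along a random sequence, then so is [limn]. *)
Lemma limn_of_limn_sup u a b : bounded_fun u ->
  limn_sup u = a -> limn_sup (fun n => - u n) = b ->
  limn u = if a == - b then a else point.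
Proof.
move=> bu ha hb.
have bNu : bounded_fun (fun n => - u n).
  move: bu => [M [Mr hM]]; exists M; split => // x Mx t _.
  by rewrite /= normrN; exact: hM.
case: eqP => [ab|ab].
  apply/cvg_lim => //.
  have cu := cvg_limn_sup u bu; rewrite ha in cu.
  have cNu := cvgN (cvg_limn_sup _ bNu); rewrite hb -ab in cNu.
  apply: (squeeze_cvgr _ (cNu _) cu); apply: nearW => n; apply/andP; split.
    rewrite lerNl; apply: ub_le_sup; last by exists n => /=.
    exact/has_ubound_sdrop/bounded_fun_has_ubound.
  apply: ub_le_sup; last by exists n => /=.
  exact/has_ubound_sdrop/bounded_fun_has_ubound.
apply: dvgP => cu; apply: ab.
rewrite -ha -hb (cvg_limn_supE cu).
have cNu : cvgn (fun n => - u n) by exact: is_cvgN.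
rewrite (cvg_limn_supE cNu).
by rewrite (limN cu) opprK.
Qed.

End upper_limits.

Section ergodic.
Context {d} {X : measurableType d} {R : realType}.
Variables (mu : probability X R) (f : X -> X).
Hypotheses (mf : measurable_fun setT f) (erg : ergodic_measure mu f).

Lemma le_measure_ae (A B : set X) : measurable A -> measurable B ->
  {ae mu, forall x, A x -> B x} -> (mu A <= mu B)%E.
Proof.
move=> mA mB [N [mN N0 AB]].
have -> : mu B = (mu B + mu N)%E by rewrite [X in (_ + X)%E]N0 adde0.
apply: le_trans (measureU2 _ mB mN); apply: le_measure; rewrite ?inE //.
  exact: measurableU.
move=> x Ax; have [Bx|nBx] := pselect (B x); first by left.
by right; apply: AB => /(_ Ax).
Qed.

Lemma ae_comp_iter (P : X -> Prop) n :
  {ae mu, forall x, P x} -> {ae mu, forall x, P (iter n f x)}.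
Proof.
elim: n P => // n IH P h; apply: (IH (fun x => P (f x))).
case: h => [N [mN N0 PN]]; exists (f @^-1` N); split.
- by rewrite -[_ @^-1` _]setTI; exact: mf.
- by rewrite erg.1.
- by move=> x Px; exact: PN.
Qed.

(** An almost invariant set is almost equal to the set of points whose orbit
    meets it infinitely often, which is strictly invariant. *)
Lemma almost_invariant_01 (E : set X) : measurable E ->
  {ae mu, forall x, E (f x) <-> E x} -> mu E = 0%E \/ mu E = 1%E.
Proof.
move=> mE inv.
pose F n := iter n f @^-1` E.
have mF n : measurable (F n).
  rewrite /F; elim: n => // n IH.
  have -> : iter n.+1 f @^-1` E = f @^-1` (iter n f @^-1` E).
    by apply/seteqP; split=> x; rewrite /preimage /= -iterSr.
  by rewrite -[_ @^-1` _]setTI; exact: mf.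
have mA : measurable (lim_sup_set F).
  by apply: bigcap_measurableType => k _; exact: bigcup_measurable.
have invA : f @^-1` lim_sup_set F = lim_sup_set F.
  apply/seteqP; split=> x h n _ /=.
    have [j /= nj] := h n I; exists j.+1; first exact: leqW.
    by rewrite /F /preimage /= -iterS iterSr.
  have [[|j] //= nj] := h n.+1 I; exists j => //=.
  by rewrite /F /preimage /= -iterSr.
(* almost every orbit stays in [E] or stays outside *)
have allF : {ae mu, forall x, forall n, F n x <-> E x}.
  apply: (@ae_foralln _ _ _ mu (fun n x => F n x <-> E x)) => n.
  elim: n => [|n IH]; first by apply: aeW => x.
  apply: (filterS2 _ _ IH (ae_comp_iter _ n inv)) => x h1 h2.
  by rewrite /F /preimage /=; split=> [/h2/h1|/h1/h2].
have <- : mu (lim_sup_set F) = mu E.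
  apply/le_anti/andP; split; apply: le_measure_ae => //.
    apply: filterS allF => x h hx; have [j _] := hx 0%N I; exact: (h j).1.
  apply: filterS allF => x h Ex n _; exists n => /=; first exact: leqnn.
  exact/h.
exact: erg.2.
Qed.

(** The level sets of an almost invariant function obey the zero-one law, so
    its distribution function jumps from 0 to 1 at a single value. *)
Lemma almost_invariant_cst (g : X -> R) (M : R) : measurable_fun setT g ->
  (forall x, `|g x| <= M) -> {ae mu, forall x, g (f x) = g x} ->
  exists c, {ae mu, forall x, g x = c}.
Proof.
move=> mg gM inv.
pose L q := [set x | g x < q].
have mL q : measurable (L q).
  have -> : L q = setT `&` g @^-1` `]-oo, q[%classic.
    by rewrite setTI; apply/seteqP; split => x; rewrite /L /= in_itv.
  exact: mg.
have L01 q : mu (L q) = 0%E \/ mu (L q) = 1%E.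
  apply: almost_invariant_01 => //; apply: filterS inv => x h.
  by rewrite /L /= h.
pose D := [set q | mu (L q) = 0%E].
have DM : D (- M).
  rewrite /D /= (_ : L (- M) = set0) ?measure0 //.
  apply/seteqP; split => // x; rewrite /L /=.
  by have := gM x; rewrite ler_norml => /andP[+ _]; rewrite leNgt => /negP.
have ubD : ubound D (M + 1).
  move=> q Dq; rewrite leNgt; apply/negP => qM.
  have : mu (L q) = 1%E.
    rewrite (_ : L q = setT) ?probability_setT //.
    apply/seteqP; split => // x _; rewrite /L /=; have := gM x.
    by rewrite ler_norml => /andP[_]; lra.
  by rewrite Dq => /eqP; rewrite eq_sym onee_eq0.
have hsD : has_sup D by split; [exists (- M)|exists (M + 1)].
exists (sup D).
have lower k : {ae mu, forall x, sup D - k.+1%:R^-1 <= g x}.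
  have k0 : 0 < k.+1%:R^-1 :> R by rewrite invr_gt0.
  have [q Dq hq] := sup_adherent k0 hsD.
  exists (L q); split => // x /= /negP; rewrite -ltNge => h.
  exact: lt_trans h hq.
have upper k : {ae mu, forall x, g x <= sup D + k.+1%:R^-1}.
  have k0 : 0 < k.+1%:R^-1 :> R by rewrite invr_gt0.
  have : mu (L (sup D + k.+1%:R^-1)) = 1%E.
    case: (L01 (sup D + k.+1%:R^-1)) => // h.
    have /(ub_le_sup hsD.2) : D (sup D + k.+1%:R^-1) by [].
    by rewrite gerDl leNgt k0.
  move=> h; exists (~` L (sup D + k.+1%:R^-1)); split.
  - exact: measurableC.
  - by rewrite probability_setC // h subee.
  - by move=> x /= + /ltW; exact.
apply: filterS2 (ae_foralln lower) (ae_foralln upper) => x lo up.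
apply/le_anti/andP; split; apply/ler_addgt0Pr => e e0.
  have [k /ltW ke] : exists k, k.+1%:R^-1 < e.
    by exists (Num.truncn e^-1); rewrite invf_plt ?posrE // truncnS_gt.
  by apply: le_trans (up k) _; rewrite lerD2l.
have [k /ltW ke] : exists k, k.+1%:R^-1 < e.
  by exists (Num.truncn e^-1); rewrite invf_plt ?posrE // truncnS_gt.
have /= := lo k; rewrite lerBlDr => /le_trans; apply; by rewrite lerD2l.
Qed.
End ergodic.

Section almost_everywhere.
Context {d} {X : measurableType d} {R : realType} (mu : probability X R).

Lemma ae_forall_countable (T : countType) (P : T -> X -> Prop) :
  (forall i, {ae mu, forall x, P i x}) -> {ae mu, forall x, forall i, P i x}.
Proof.
move=> h; pose Q k x := if unpickle k is Some i then P i x else True.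
have : {ae mu, forall x, forall k, Q k x}.
  apply: ae_foralln => k; rewrite /Q.
  by case: (unpickle k) => [i|]; [exact: h|exact: aeW].
by apply: filterS => x hx i; have := hx (pickle i); rewrite /Q pickleK.
Qed.

Lemma ae_exists (P : X -> Prop) : {ae mu, forall x, P x} -> exists x, P x.
Proof.
move=> [B [mB B0 PB]]; apply: contrapT => /forallNP nP.
have BT : B = setT by apply/seteqP; split => // x _; apply: PB; exact: nP.
by move: B0; rewrite BT probability_setT => /eqP; rewrite onee_eq0.
Qed.

(** The Borel-Cantelli lemma with a geometric bound. *)
Lemma ae_eventually_not (F : nat -> set X) (e : R) : 0 < e < 1 ->
  (forall n, measurable (F n)) -> (forall n, (mu (F n) <= (e ^+ n)%:E)%E) ->
  {ae mu, forall x, \forall n \near \oo, ~ F n x}.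
Proof.
move=> /andP[e0 e1] mF muF.
exists (lim_sup_set F); split.
- by apply: bigcap_measurableType => k _; exact: bigcup_measurable.
- apply: lim_sup_set_cvg0 => //.
  apply: (@le_lt_trans _ _ ((1 - e)^-1)%:E); last exact: ltry.
  apply: lime_le; first exact: is_cvg_nneseries.
  apply: nearW => n.
  apply: (@le_trans _ _ (\sum_(0 <= i < n) (e ^+ i)%:E)%E).
    by apply: lee_sum => i _; exact: muF.
  rewrite sumEFin lee_fin.
  have := @geometric_le_lim R n 1 e ler01 e0; rewrite ger0_norm ?(ltW e0) //.
  move=> /(_ e1); rewrite mul1r; apply: le_trans.
  by rewrite /series /=; apply: ler_sum => i _; rewrite mul1r.
move=> x /= h n _; apply: contrapT => hn; apply: h; exists n => // k /= nk Fk.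
by apply: hn; exists k.
Qed.

End almost_everywhere.

(** * Growth of the projected norms *)

Section projected_norms.
Context {R : realType} {m : nat}.
Implicit Types (c d : 'I_m -> R) (p r : R) (I : seq 'I_m).

(** [p] is the squared cosine of the angle between the line and the first
    axis. *)
Definition projnorm c d p I : R :=
  Num.sqrt (p * altprod c d I ^+ 2 + (1 - p) * altprod d c I ^+ 2).

Lemma projnorm_between c d p I : 0 <= p <= 1 ->
  (forall i, 0 < `|c i|) -> (forall i, 0 < `|d i|) ->
  Num.min (altprod c d I) (altprod d c I) <= projnorm c d p I
    <= Num.max (altprod c d I) (altprod d c I).
Proof.
move=> /andP[p0 p1] hc hd.
have a0 := altprod_gt0 c d I hc hd; have b0 := altprod_gt0 d c I hd hc.
set a := altprod c d I in a0 *; set b := altprod d c I in b0 *.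
have q0 : 0 <= 1 - p by rewrite subr_ge0.
have sq (x y : R) : 0 <= x -> x <= y -> x ^+ 2 <= y ^+ 2.
  by move=> x0 xy; rewrite lerXn2r ?nnegrE // (le_trans x0).
have m0 : 0 <= Num.min a b by rewrite le_min !ltW.
have M0 : 0 <= Num.max a b by rewrite le_max ltW.
have key x : p * x + (1 - p) * x = x by rewrite -mulrDl addrC subrK mul1r.
rewrite /projnorm -/a -/b; apply/andP; split.
  rewrite -[leLHS](ger0_norm m0) -sqrtr_sqr ler_wsqrtr //.
  rewrite -[leLHS]key lerD // ler_wpM2l // sq // ge_min lexx ?orbT //.
rewrite -[leRHS](ger0_norm M0) -sqrtr_sqr ler_wsqrtr //.
by rewrite -[leRHS]key lerD // ler_wpM2l // sq ?(ltW a0) ?(ltW b0) //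
  le_max lexx ?orbT.
Qed.

Lemma projnorm_gt0 c d p I : 0 <= p <= 1 ->
  (forall i, 0 < `|c i|) -> (forall i, 0 < `|d i|) -> 0 < projnorm c d p I.
Proof.
move=> hp hc hd; have /andP[+ _] := projnorm_between c d p I hp hc hd.
by apply: lt_le_trans; rewrite lt_min !altprod_gt0.
Qed.

Lemma altprod_le c d I (rho : R) :
  (forall i, `|c i| <= rho) -> (forall i, `|d i| <= rho) ->
  altprod c d I <= rho ^+ size I.
Proof.
elim: I c d => //= i I IH c d hc hd; rewrite exprS ler_pM // ?IH //.
by elim: I c d {IH hc hd} => //= j I IH c d; rewrite mulr_ge0.
Qed.

Lemma projnorm_le c d p I (rho : R) : 0 <= p <= 1 ->
  (forall i, 0 < `|c i| <= rho) -> (forall i, 0 < `|d i| <= rho) ->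
  projnorm c d p I <= rho ^+ size I.
Proof.
move=> hp hc hd.
have hc1 i : 0 < `|c i| by case/andP: (hc i).
have hd1 i : 0 < `|d i| by case/andP: (hd i).
have hc2 i : `|c i| <= rho by case/andP: (hc i).
have hd2 i : `|d i| <= rho by case/andP: (hd i).
have /andP[_ +] := projnorm_between c d p I hp hc1 hd1.
by move/le_trans; apply; rewrite ge_max !altprod_le.
Qed.

Lemma altprod_ratio c d r I : (forall i, `|c i| = r * `|d i|) ->
  altprod c d I = (if odd (size I) then r else 1) * altprod d c I.
Proof.
move=> hr; elim: I => [|i I IH] /=; first by rewrite mul1r.
by rewrite IH hr; case: (odd _) => /=; ring.
Qed.

Lemma ln_projnorm_altprod c d r p I : 0 <= p <= 1 -> 0 < r ->
  (forall i, 0 < `|c i|) -> (forall i, 0 < `|d i|) ->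
  (forall i, `|c i| = r * `|d i|) ->
  `|ln (altprod c d I) - ln (altprod d c I)| <= `|ln r| /\
  `|ln (projnorm c d p I) - ln (altprod c d I)| <= `|ln r|.
Proof.
move=> hp r0 hc hd hr.
have a0 := altprod_gt0 c d I hc hd; have b0 := altprod_gt0 d c I hd hc.
have n0 := projnorm_gt0 c d p I hp hc hd.
have AB : `|ln (altprod c d I) - ln (altprod d c I)| <= `|ln r|.
  rewrite (altprod_ratio c d r I hr) lnM ?posrE //; last by case: ifP.
  by rewrite addrK; case: ifP => _ //; rewrite ln1 normr0.
split=> //.
have := projnorm_between c d p I hp hc hd.
move: AB; set P := projnorm _ _ _ _ in n0 *.
rewrite !ler_norml ge_min le_max => /andP[h1 h2] /andP[/orP h3 /orP h4].
have mono (x y : R) : 0 < x -> x <= y -> ln x <= ln y.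
  by move=> x0 xy; rewrite ler_ln ?posrE // (lt_le_trans x0).
by apply/andP; split; case: h3 => [/(mono _ _ a0)|/(mono _ _ b0)] h3;
  case: h4 => /(mono _ _ n0) h4; lra.
Qed.

(** When the ratio is constant, both rows of a product have comparable norms,
    so prepending a letter, which exchanges their roles, changes the projected
    norm by a bounded factor only. *)
Lemma ln_projnorm_cons c d r p : 0 <= p <= 1 -> 0 < r ->
  (forall i, 0 < `|c i|) -> (forall i, 0 < `|d i|) ->
  (forall i, `|c i| = r * `|d i|) ->
  exists C, forall i I,
    `|ln (projnorm c d p (i :: I)) - ln (projnorm c d p I)| <= C.
Proof.
move=> hp r0 hc hd hr.
exists (3 * `|ln r| + \sum_i `|ln `|c i| |) => i I.
have [_ h1] := ln_projnorm_altprod c d r p (i :: I) hp r0 hc hd hr.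
have [h2 h3] := ln_projnorm_altprod c d r p I hp r0 hc hd hr.
have hi : `|ln `|c i| | <= \sum_i `|ln `|c i| |.
  by rewrite (bigD1 i) //= lerDl sumr_ge0.
move: h1 => /=; rewrite lnM ?posrE ?altprod_gt0 //.
move: h2 h3 hi; rewrite !ler_norml.
by do 4 (case/andP=> ? ?); apply/andP; split; lra.
Qed.

End projected_norms.

(** * Local exponents along orbits *)

Section local_exponents.
Context {R : realType} {m : nat} {hm : (2 <= m)%N}.
Notation X := (borel (shift_space hm)).
Variable mu : probability X R.
Implicit Types (x : shift_space hm) (I : seq 'I_m) (W : {vspace 'cV[R]_2}).
Implicit Type T : 'I_m -> 'M[R]_2.

(** The information content of a cylinder, whose linear growth rate along a
    point is the local entropy. *)
Definition info I : R := - ln (fine (mu (cylinder hm I))).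

Lemma fine_cylinder I :
  mu (cylinder hm I) = (fine (mu (cylinder hm I)))%:E.
Proof. by rewrite fineK // fin_num_measure //; exact: measurable_cylinder. Qed.

Lemma cylinder_le1 I : (mu (cylinder hm I) <= 1)%E.
Proof. apply: probability_le1; exact: measurable_cylinder. Qed.

Lemma info_ge0 I : 0 <= info I.
Proof.
rewrite /info oppr_ge0 ln_le0 //.
by rewrite -lee_fin -fine_cylinder cylinder_le1.
Qed.

Lemma S_n_itv T W x n : 0 <= S_n mu T W x n <= 1.
Proof.
rewrite /S_n; set A := [set s | _].
have A0 : A 0 by rewrite /A /= lexx ler01 /phi powRr0 cylinder_le1.
have ubA : ubound A 1 by move=> s [/andP[_ ?] _].
apply/andP; split; last by apply: ge_sup => //; exists 0.
by apply: ub_le_sup => //; exists 1.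
Qed.

Lemma norm_S_n T W x n : `|S_n mu T W x n| <= 1.
Proof. by have /andP[h0 h1] := S_n_itv T W x n; rewrite ger0_norm. Qed.

Lemma bounded_S_n T W x : bounded_fun (S_n mu T W x).
Proof.
exists 1; split => // M M1 n _; exact: le_trans (norm_S_n _ _ _ _) (ltW M1).
Qed.

Lemma measurable_prefix (P : seq 'I_m -> Prop) n :
  measurable ([set x : shift_space hm | P (prefix_word x n)] : set X).
Proof.
pose F (I : seq 'I_m) : set X :=
  if `[< P I /\ size I = n >] then cylinder hm I else set0.
have -> : ([set x : shift_space hm | P (prefix_word x n)] : set X)
    = \bigcup_I F I.
  apply/seteqP; split => [x /= Px|x [I _]].
    exists (prefix_word (x : shift_space hm) n) => //; rewrite /F.
    case: asboolP => [_|[]]; first exact: prefix_word_cylinder.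
    by split=> //; rewrite size_mkseq.
  rewrite /F; case: asboolP => // -[PI sI]; rewrite /cylinder /= sI.
  by move=> ->.
apply: countable_bigcupT_measurable; first exact: countableP.
move=> I; rewrite /F; case: asboolP => _; last exact: measurable0.
exact: measurable_cylinder.
Qed.

(** [S_n] depends on the first [n] letters only. *)
Lemma measurable_S_n T W n :
  measurable_fun setT (fun x : X => S_n mu T W x n).
Proof.
move=> _ B mB; rewrite setTI.
exact: (measurable_prefix (fun I => B (sup [set s : R | 0 <= s <= 1 /\
    (mu (cylinder hm I) <= (phi s (orthoproj W *m word_mx T I))%:E)%E]))).
Qed.

Lemma ae_cylinder_gt0 :
  {ae mu, forall x : X,
    forall n, (0 < mu (cylinder hm (prefix_word (x : shift_space hm) n)))%E}.
Proof.
have h : {ae mu, forall x : X, forall I : seq 'I_m,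
    cylinder hm I x -> (0 < mu (cylinder hm I))%E}.
  apply: ae_forall_countable => I.
  have := measure_ge0 mu (cylinder hm I).
  rewrite le_eqVlt => /orP[/eqP h0|h0]; last by apply: aeW.
  exists (cylinder hm I); split => //; first exact: measurable_cylinder.
  by move=> x /= nI; apply: contrapT => nx; apply: nI.
apply: filterS h => x h n; apply: h; exact: prefix_word_cylinder.
Qed.

Lemma S_nE T W x n :
  (0 < mu (cylinder hm (prefix_word x n)))%E ->
  0 < alpha1 (orthoproj W *m word_mx T (prefix_word x n)) < 1 ->
  S_n mu T W x n = clipped_ratio (info (prefix_word x n))
     (- ln (alpha1 (orthoproj W *m word_mx T (prefix_word x n)))).
Proof.
move=> mu0 a01; rewrite /info -sup_exponent //; first by rewrite -fine_cylinder.
by rewrite -!lee_fin -lte_fin -fine_cylinder mu0 cylinder_le1.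
Qed.

Hypothesis inv : invariant_measure mu (@shift_map m hm).

Lemma measure_cons_le i I :
  (mu (cylinder hm (i :: I)) <= mu (cylinder hm I))%E.
Proof.
rewrite -(inv _ (measurable_cylinder I)); apply: le_measure; rewrite ?inE.
- exact: measurable_cylinder.
- rewrite -[_ @^-1` _]setTI; apply: measurable_shift_map => //.
  exact: measurable_cylinder.
- by rewrite shift_map_cylinder => x h; exists i.
Qed.

Lemma prefix_wordS (x : shift_space hm) n :
  prefix_word x n.+1 = x 0%N :: prefix_word (shift_map x) n.
Proof.
by rewrite /prefix_word /mkseq /= (iotaDl 1 0) -map_comp.
Qed.

(** For each letter [i], the points starting with [i] whose conditional
    probability given the shifted cylinder is below [e ^ n] have measure at
    most [e ^ n], so by Borel-Cantelli prepending a letter almost surely does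
    not change the information by more than a small multiple of [n]. *)
Lemma ae_cylinder_cons (e : R) : 0 < e < 1 ->
  {ae mu, forall x : X, \forall n \near \oo,
    ((e ^+ n)%:E
        * mu (cylinder hm (prefix_word (shift_map (x : shift_space hm)) n))
      <= mu (cylinder hm (prefix_word (x : shift_space hm) n.+1)))%E}.
Proof.
move=> e01; have /andP[e0 e1] := e01.
pose F (i : 'I_m) n : set X := [set x : shift_space hm | x 0%N = i /\
  (mu (cylinder hm (prefix_word x n.+1)) <
   (e ^+ n)%:E * mu (cylinder hm (prefix_word (shift_map x) n)))%E].
pose D i n : set (n.-tuple 'I_m) := [set I : n.-tuple 'I_m |
  (mu (cylinder hm (i :: I)) < (e ^+ n)%:E * mu (cylinder hm I))%E].
have FD i n : F i n = \bigcup_(I in D i n) cylinder hm (i :: I).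
  apply/seteqP; split => x.
    move=> [xi h].
    have sz : size (prefix_word (shift_map (x : shift_space hm)) n) == n.
      by rewrite size_mkseq.
    exists (Tuple sz); first by rewrite /D /= -xi -prefix_wordS.
    rewrite /= -xi -prefix_wordS; exact: prefix_word_cylinder.
  move=> [I DI]; rewrite /cylinder /= size_tuple => h.
  have [h0 hI] : x 0%N = i /\
      prefix_word (shift_map (x : shift_space hm)) n = tval I.
    by move: h; rewrite prefix_wordS => -[].
  by split => //; rewrite h hI.
have tI n (E : set (n.-tuple 'I_m)) :
    trivIset E (fun I : n.-tuple _ => cylinder hm I).
  apply/trivIsetP => I J _ _ IJ; apply/seteqP; split => // x.
  rewrite /cylinder /= => -[]; rewrite !size_tuple => -> /val_inj h.
  by rewrite h eqxx in IJ.
have tiI i n (E : set (n.-tuple 'I_m)) :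
    trivIset E (fun I : n.-tuple _ => cylinder hm (i :: I)).
  apply/trivIsetP => I J _ _ IJ; apply/seteqP; split => // x.
  rewrite /cylinder /= => -[]; rewrite !size_tuple => -> [] /val_inj h.
  by rewrite h eqxx in IJ.
have mF i n : measurable (F i n).
  rewrite FD; apply: fin_bigcup_measurable; first exact: finite_finset.
  by move=> I _; exact: measurable_cylinder.
have muF i n : (mu (F i n) <= (e ^+ n)%:E)%E.
  have mc (J : n.-tuple 'I_m) : measurable (cylinder hm J : set X).
    exact: measurable_cylinder.
  rewrite FD measure_fin_bigcup //.
  - apply: (@le_trans _ _
      (\sum_(I \in D i n) ((e ^+ n)%:E * mu (cylinder hm I)))%E).
      apply: lee_fsum; first exact: finite_finset.
      by move=> I /ltW.
    rewrite -ge0_mule_fsumr // -measure_fin_bigcup //.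
    + rewrite -[leRHS]mule1 lee_wpmul2l ?lee_fin ?exprn_ge0 ?(ltW e0) //.
      apply: probability_le1; apply: fin_bigcup_measurable => //.
      exact: finite_finset.
    + exact: finite_finset.
    + exact: tI.
  - exact: finite_finset.
  - exact: tiI.
  - by move=> I _; exact: measurable_cylinder.
have : {ae mu, forall x : X, forall i, \forall n \near \oo, ~ F i n x}.
  by apply: ae_forall_countable => i; exact: (ae_eventually_not mu (F i) e).
apply: filterS => x /(_ ((x : shift_space hm) 0%N)).
apply: filterS => n /= h; rewrite leNgt; apply/negP => h'; apply: h.
by split.
Qed.

End local_exponents.

(** * Constant ratio: local exponents are almost surely constant *)

Section constant_ratio.
Context {R : realType} {m : nat} {hm : (2 <= m)%N}.
Notation X := (borel (shift_space hm)).
Implicit Types (c d : 'I_m -> R) (x : shift_space hm) (u : 'cV[R]_2).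

Lemma exists_contraction c d :
  (forall i, 0 < `|c i| < 1) -> (forall i, 0 < `|d i| < 1) ->
  exists rho, [/\ 0 < rho < 1, forall i, 0 < `|c i| <= rho &
    forall i, 0 < `|d i| <= rho].
Proof.
move=> hc hd.
exists (\big[Order.max/2^-1]_i Num.max `|c i| `|d i|); split.
- apply/andP; split.
    by apply: lt_le_trans (bigmax_ge_id _ _ _ _); rewrite invr_gt0.
  apply: bigmax_lt => [|i _]; first by rewrite invf_lt1 // ltr1n.
  by rewrite gt_max; case/andP: (hc i) => _ ->; case/andP: (hd i).
- move=> i; case/andP: (hc i) => -> _ /=.
  by apply: le_trans (le_bigmax _ _ i); rewrite le_max lexx.
- move=> i; case/andP: (hd i) => -> _ /=.
  by apply: le_trans (le_bigmax _ _ i); rewrite le_max lexx orbT.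
Qed.

Lemma cos2_itv u : u != 0 -> 0 <= u 0 0 ^+ 2 / normsq u <= 1.
Proof.
move=> u0; have q0 := normsq_gt0 _ u0.
rewrite divr_ge0 ?sqr_ge0 ?(ltW q0) //= ler_pdivrMr // mul1r /normsq.
by rewrite lerDl sqr_ge0.
Qed.

Variable mu : probability X R.

Lemma S_n_projnorm c d u x n : u != 0 ->
  (forall i, 0 < `|c i| < 1) -> (forall i, 0 < `|d i| < 1) ->
  (0 < n)%N -> (0 < mu (cylinder hm (prefix_word x n)))%E ->
  S_n mu (fun i => antidiag_mx (c i) (d i)) <[u]>%VS x n =
  clipped_ratio (info mu (prefix_word x n))
    (- ln (projnorm c d (u 0 0 ^+ 2 / normsq u) (prefix_word x n))).
Proof.
move=> u0 hc hd n0 mu0.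
have hc0 i : 0 < `|c i| by case/andP: (hc i).
have hd0 i : 0 < `|d i| by case/andP: (hd i).
have aE := alpha1_proj_word c d u (prefix_word x n) u0 hc0 hd0.
rewrite S_nE //; first by rewrite aE.
rewrite aE -/(projnorm _ _ _ _) projnorm_gt0 ?cos2_itv //=.
have [rho [/andP[r0 r1] hcr hdr]] := exists_contraction c d hc hd.
apply: le_lt_trans (projnorm_le _ _ _ _ _ (cos2_itv _ u0) hcr hdr) _.
by rewrite size_mkseq exprn_ilt1 ?ltW // -lt0n.
Qed.

Hypothesis inv : invariant_measure mu (@shift_map m hm).

(** The inequality [mu [iI] <= mu [I]] gives one half of this estimate, and
    Borel-Cantelli with the ratios [exp (- 1 / k)] gives the other. *)
Lemma ae_info_cons :
  {ae mu, forall x : X, forall e : R, 0 < e -> \forall n \near \oo,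
    `|info mu (prefix_word (x : shift_space hm) n.+1)
      - info mu (prefix_word (shift_map (x : shift_space hm)) n)| <= n%:R * e}.
Proof.
have h k := ae_cylinder_cons mu (expR (- k.+1%:R^-1)).
have e01 k : 0 < expR (- k.+1%:R^-1 : R) < 1.
  by rewrite expR_gt0 expR_lt1 oppr_lt0 invr_gt0 ltr0n.
apply: filterS2 (ae_cylinder_gt0 mu)
  (@ae_foralln _ _ _ mu _ (fun k => h k (e01 k))) => x pos hx e e0.
have [k /ltW ke] : exists k, k.+1%:R^-1 < e.
  by exists (Num.truncn e^-1); rewrite invf_plt ?posrE // truncnS_gt.
apply: filterS (hx k) => n.
have := pos n.+1.
have := measure_cons_le mu inv ((x : shift_space hm) 0%N) 
  (prefix_word (shift_map (x : shift_space hm)) n).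
rewrite prefix_wordS.
set I := _ :: _; set J := prefix_word _ _.
rewrite (fine_cylinder mu I) (fine_cylinder mu J) -EFinM !lee_fin lte_fin /info.
set a := fine _; set b := fine _ => ab a0 hh.
have b0 : 0 < b by exact: lt_le_trans ab.
have l1 : ln a <= ln b by rewrite ler_ln ?posrE.
have l2 : ln b - n%:R * k.+1%:R^-1 <= ln a.
  have -> : ln b - n%:R * k.+1%:R^-1 = ln (expR (- k.+1%:R^-1) ^+ n * b).
    rewrite lnM ?posrE ?exprn_gt0 ?expR_gt0 // lnXn ?expR_gt0 // expRK.
    by rewrite -[(- _) *+ n]mulr_natl mulrN addrC.
  by rewrite ler_ln ?posrE ?mulr_gt0 ?exprn_gt0 ?expR_gt0.
have : n%:R * k.+1%:R^-1 <= n%:R * e by rewrite ler_wpM2l.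
have ne0 : 0 <= n%:R * e by rewrite mulr_ge0 // ltW.
move: l1 l2 ne0; rewrite ler_norml.
move: (ln a) (ln b) (n%:R / k.+1%:R) (n%:R * e) => A B y z *.
by apply/andP; split; lra.
Qed.

(** Both terms of the ratio defining [S_n] change negligibly when a point is
    replaced by its shift: the information by [ae_info_cons], the norm by
    [ln_projnorm_cons]. *)
Lemma ae_S_n_shift c d r u : u != 0 -> 0 < r ->
  (forall i, 0 < `|c i| < 1) -> (forall i, 0 < `|d i| < 1) ->
  (forall i, `|c i| = r * `|d i|) ->
  let S := S_n mu (fun i => antidiag_mx (c i) (d i)) <[u]>%VS in
  {ae mu, forall x : X, S (x : shift_space hm) n.+1
     - S (shift_map (x : shift_space hm)) n @[n --> \oo] --> 0}.
Proof.
move=> u0 r0 hc hd hr S.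
have hc0 i : 0 < `|c i| by case/andP: (hc i).
have hd0 i : 0 < `|d i| by case/andP: (hd i).
have hp := cos2_itv _ u0; set p := (X in 0 <= X <= 1) in hp.
have [rho [/andP[rho0 rho1] hcr hdr]] := exists_contraction c d hc hd.
have [C hC] := ln_projnorm_cons c d r p hp r0 hc0 hd0 hr.
have b0 : 0 < - ln rho by rewrite oppr_gt0 ln_lt0 // rho0.
have lI I : (size I)%:R * - ln rho <= - ln (projnorm c d p I).
  rewrite mulrN lerN2 mulr_natl -lnXn //.
  rewrite ler_ln ?posrE ?exprn_gt0 ?projnorm_gt0 //.
  exact: projnorm_le.
apply: filterS2 (ae_cylinder_gt0 mu) ae_info_cons => x pos hx.
have posS n :
    (0 < mu (cylinder hm (prefix_word (shift_map (x : shift_space hm)) n)))%E.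
  apply: lt_le_trans (pos n.+1) _; rewrite prefix_wordS; exact: measure_cons_le.
pose a n := info mu (prefix_word (x : shift_space hm) n.+1).
pose l n := - ln (projnorm c d p (prefix_word (x : shift_space hm) n.+1)).
pose a' n := info mu (prefix_word (shift_map (x : shift_space hm)) n).
pose l' n :=
  - ln (projnorm c d p (prefix_word (shift_map (x : shift_space hm)) n)).
have := cvg_clipped_ratio_sub a l a' l' (- ln rho) C b0 _ hx.
have H n : (0 < n)%N -> [/\ n%:R * - ln rho <= l n, 0 < l' n, 0 <= a' n &
     `|l n - l' n| <= C].
  move=> n0; split.
  - apply: le_trans (lI _); rewrite size_mkseq ler_wpM2r ?ltW //.
    by rewrite ltr_nat.
  - by apply: lt_le_trans (lI _); rewrite size_mkseq mulr_gt0 // ltr0n.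
  - exact: info_ge0.
  - by rewrite /l /l' prefix_wordS opprK addrC distrC; exact: hC.
move=> /(_ H); apply: cvg_trans; apply: near_eq_cvg.
exists 1%N => // n /= n0.
by rewrite /S !S_n_projnorm.
Qed.

(** The upper limits of [S_n] and of [- S_n] are almost invariant, hence
    almost surely constant by ergodicity. *)
Lemma S_lim_ae_cst c d r u : ergodic_measure mu (@shift_map m hm) ->
  u != 0 -> 0 < r ->
  (forall i, 0 < `|c i| < 1) -> (forall i, 0 < `|d i| < 1) ->
  (forall i, `|c i| = r * `|d i|) ->
  exists k, {ae mu, forall x : X,
    S_lim mu (fun i => antidiag_mx (c i) (d i)) <[u]>%VS x = k}.
Proof.
move=> erg u0 r0 hc hd hr.
have := ae_S_n_shift c d r u u0 r0 hc hd hr.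
set T := fun i => _; rewrite /S_lim; set S := S_n _ _ _ => hS.
have bS x : bounded_fun (S x) by exact: bounded_S_n.
have bN x : bounded_fun (fun n => - S x n).
  move: (bS x) => [M [Mr hM]]; exists M; split => // y My t _.
  by rewrite /= normrN; exact: hM.
have bSh x (v : nat -> R) : bounded_fun v -> bounded_fun (fun n => v n.+1).
  by move=> [M [Mr hM]]; exists M; split => // y My t _; exact: hM.
have step (v : shift_space hm -> nat -> R) :
    (forall x, bounded_fun (v x)) -> (forall x n, `|v x n| <= 1) ->
    (forall n, measurable_fun setT (v ^~ n : X -> R)) ->
    {ae mu, forall x : X, v x n.+1 - v (shift_map (x : shift_space hm)) n
       @[n --> \oo] --> 0} ->
    exists k, {ae mu, forall x : X, limn_sup (v x) = k}.
  move=> bv nv mv hv.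
  apply: (almost_invariant_cst mu _ measurable_shift_map erg
    (fun x : X => limn_sup (v x)) 1).
  - apply: measurable_fun_limn_sup => // x _.
      exact: bounded_fun_has_ubound.
    exact: bounded_fun_has_lbound.
  - move=> x; have bc (t : R) : bounded_fun (fun _ : nat => t).
      by exists `|t|; split => // M /ltW tM.
    have lc (t : R) : limn_sup (fun _ : nat => t) = t.
      have ct : (fun _ : nat => t) @ \oo --> t by exact: cvg_cst.
      by rewrite cvg_limn_supE; [exact: (cvg_lim _ ct)|exact: (cvgP _ ct)].
    have nv' n : - 1 <= v x n <= 1 by rewrite -ler_norml.
    rewrite ler_norml -{1}(lc (- 1)) -{2}(lc 1) !le_limn_sup // => e e0;
      by apply: nearW => n; have := nv' n; lra.
  - apply: filterS hv => x hx; rewrite -[RHS]limn_sup_shift //.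
    by apply/esym/limn_sup_cvg0 => //; exact: bSh.
have [k1 h1] : exists k, {ae mu, forall x : X, limn_sup (S x) = k}.
  apply: step => // [x n|n]; first exact: norm_S_n.
  exact: measurable_S_n.
have [k2 h2] : exists k, {ae mu, forall x : X, limn_sup (fun n => - S x n) = k}.
  apply: (step (fun x n => - S x n)) => // [x n|n|].
  - by rewrite normrN; exact: norm_S_n.
  - apply: measurableT_comp => //; exact: measurable_S_n.
  - apply: filterS hS => x /cvgN; rewrite oppr0; apply: cvg_trans.
    by apply: near_eq_cvg; apply: nearW => n; rewrite /= opprB addrC opprK.
exists (if k1 == - k2 then k1 else point).
apply: filterS2 h1 h2 => x e1 e2; exact: limn_of_limn_sup.
Qed.

Lemma S_upper_lower_eq c d r (W : {vspace 'cV[R]_2}) :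
  ergodic_measure mu (@shift_map m hm) -> \dim W = 1%N -> 0 < r ->
  (forall i, 0 < `|c i| < 1) -> (forall i, 0 < `|d i| < 1) ->
  (forall i, `|c i| = r * `|d i|) ->
  S_upper mu (fun i => antidiag_mx (c i) (d i)) W
  = S_lower mu (fun i => antidiag_mx (c i) (d i)) W.
Proof.
move=> erg dW r0 hc hd hr.
have Wn0 : W != 0%VS by rewrite -dimv_eq0 dW.
have un0 : vpick W != 0 by rewrite vpick0.
have -> : W = <[vpick W]>%VS.
  by apply/esym/eqP; rewrite eqEdim -memvE memv_pick dW dim_vline un0.
have [k hk] := S_lim_ae_cst c d r (vpick W) erg un0 r0 hc hd hr.
have mu0 : (0 < mu setT)%E by rewrite probability_setT.
have hk' : {ae mu, forall x : X, (EFin \o S_lim mu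
    (fun i => antidiag_mx (c i) (d i)) <[vpick W]>%VS) x = k%:E}.
  by apply: filterS hk => x /= ->.
rewrite /S_upper /S_lower (ess_sup_ae_cst _ mu0 hk').
by rewrite (ess_inf_ae_cst _ mu0 hk').
Qed.

End constant_ratio.

(** * Random concatenation of two words *)

Section pushforward.
Context {d d'} {T : measurableType d} {T' : measurableType d'} {R : realType}.

Lemma exists_pushforward (mu : {measure set T -> \bar R}) (f : T -> T') :
  measurable_fun setT f ->
  exists nu : {measure set T' -> \bar R}, forall A, nu A = mu (f @^-1` A).
Proof.
move=> mf.
by unshelve eexists (pushforward mu f : {measure set T' -> \bar R}).
Qed.

Lemma exists_pushforward_probability (mu : probability T R) (f : T -> T') :
  measurable_fun setT f ->
  exists nu : probability T' R, forall A, nu A = mu (f @^-1` A).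
Proof.
move=> mf; pose F : {mfun T >-> T'} :=
  HB.pack f (isMeasurableFun.Build _ _ _ _ f mf).
by exists (distribution mu F).
Qed.

End pushforward.

Section lebesgue.
Context {R : realType}.
Notation lambda := (@lebesgue_measure R).

Definition half_branch (b : bool) (t : R) : R := (t + b%:R) / 2.

Lemma measurable_half_branch b : measurable_fun setT (half_branch b).
Proof. by apply: measurable_funM => //; apply: measurable_funD. Qed.

(** Both sides are measures that agree on half-open intervals. *)
Lemma lebesgue_half_branch b (A : set (measurableTypeR R)) : measurable A ->
  (lambda A = (2^-1)%:E * lambda (half_branch b @^-1` A))%E.
Proof.
have [nu nuE] := @exists_pushforward _ _ (measurableTypeR R) (measurableTypeR R)
  R lambda (half_branch b) (measurable_half_branch b).
have h : 0 <= 2^-1 :> R by rewrite invr_ge0.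
move=> mA; rewrite -nuE.
rewrite (@lebesgue_measure_unique R (mscale (NngNum h) nu)) //.
move=> _ [[a c] _ <-] /=.
rewrite /mscale /= nuE.
have -> : half_branch b @^-1` `]a, c] = `]2 * a - b%:R, 2 * c - b%:R]%classic.
  apply/seteqP; split => t; rewrite /half_branch /= !in_itv /=;
    by move=> /andP[? ?]; apply/andP; split; lra.
rewrite lebesgue_measure_itv /= [in RHS]lebesgue_measure_itv /= !lte_fin.
have -> : (2 * a - b%:R < 2 * c - b%:R) = (a < c) by apply/idP/idP => ?; lra.
case: ifP => _; last by rewrite mule0.
by rewrite -!EFinB -EFinM; congr (_%:E); field.
Qed.

Definition uniform01 : set (measurableTypeR R) -> \bar R :=
  mrestr lambda (measurable_itv `[0, 1[ : measurable (`[0, 1[%classic : set R)).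

HB.instance Definition _ := Measure.on uniform01.

Lemma uniform01_setT : uniform01 setT = 1%E.
Proof.
rewrite /uniform01 /mrestr setTI lebesgue_measure_itv /= lte_fin ltr01.
by rewrite oppr0 adde0.
Qed.

HB.instance Definition _ :=
  Measure_isProbability.Build _ _ _ uniform01 uniform01_setT.

(** The first binary digit of a uniform number is a fair bit, independent of
    the number formed by the remaining digits, which is again uniform. *)
Lemma uniform01_half_branch (A : set (measurableTypeR R)) : measurable A ->
  uniform01 A = ((2^-1)%:E * uniform01 (half_branch false @^-1` A) +
    (2^-1)%:E * uniform01 (half_branch true @^-1` A))%E.
Proof.
move=> mA; rewrite /uniform01 /mrestr.
pose I b : set (measurableTypeR R) :=
  if b then `[2^-1, 1[%classic else `[0, 2^-1[%classic.
have mI b : measurable (I b : set (measurableTypeR R)).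
  by case: b; exact: measurable_itv.
have mAI b : measurable (A `&` I b : set (measurableTypeR R)).
  exact: measurableI.
have -> : A `&` `[0, 1[ = (A `&` I false) `|` (A `&` I true).
  rewrite -setIUr; congr (_ `&` _); apply/seteqP; split => t /=;
    rewrite !in_itv /=.
    move=> /andP[? ?].
    by have [?|?] := ltP t 2^-1; [left|right]; apply/andP; split; lra.
  by move=> [] /andP[? ?]; apply/andP; split; lra.
rewrite (measureU _ (mAI false) (mAI true)); last first.
  rewrite setIACA setIid; apply/seteqP; split => // t [_ []] /=.
  by rewrite !in_itv /= => /andP[? ?] /andP[? ?]; lra.
have E b : lambda (A `&` I b)
    = ((2^-1)%:E * lambda (half_branch b @^-1` A `&` `[0%R, 1%R[))%E.
  rewrite (lebesgue_half_branch b) ?preimage_setI; last exact: mAI.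
  congr (_ * lambda (_ `&` _))%E; apply/seteqP; split => t;
    rewrite /half_branch /I; case: b => /=; rewrite !in_itv /= => /andP[? ?];
    by apply/andP; split; lra.
by congr (_ + _)%E; exact: E.
Qed.

End lebesgue.

Section concatenation.
Context {R : realType} {m : nat} {hm : (2 <= m)%N}.
Notation X := (borel (shift_space hm)).
Implicit Types (x : shift_space hm) (I : seq 'I_m) (t : R).

Definition prepend I x : shift_space hm :=
  fun n => if (n < size I)%N then nth (x 0%N) I n else x (n - size I)%N.

(** The law of a random point is self-similar when prepending to it one of the
    two words, by a fair choice, leaves the law unchanged. *)
Definition self_similar (w : bool -> seq 'I_m) (nu : probability X R) : Prop :=
  forall D : set X, measurable D ->
    nu D = ((2^-1)%:E * nu (prepend (w false) @^-1` D)
          + (2^-1)%:E * nu (prepend (w true) @^-1` D))%E.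

(** The inverse of both half branches. *)
Definition doubling t : R := if t < 2^-1 then 2 * t else 2 * t - 1.

(** The binary digit of weight [2^-(q+1)], for [t] in the unit interval. *)
Definition digit q t : bool := 2^-1 <= iter q doubling t.

Lemma doubling_half_branch b t : 0 <= t < 1 -> doubling (half_branch b t) = t.
Proof.
move=> /andP[t0 t1]; rewrite /doubling /half_branch.
by case: b; case: ifP => /=; lra.
Qed.

Lemma digit0_half_branch b t : 0 <= t < 1 -> digit 0 (half_branch b t) = b.
Proof.
by move=> /andP[t0 t1]; rewrite /digit /half_branch /=; case: b => /=;
  apply/idP/idP => //=; lra.
Qed.

Lemma digitS_half_branch q b t : 0 <= t < 1 ->
  digit q.+1 (half_branch b t) = digit q t.
Proof. by move=> t01; rewrite /digit iterSr doubling_half_branch. Qed.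

Lemma measurable_digit q :
  measurable ([set t | digit q t] : set (measurableTypeR R)).
Proof.
have md :
    measurable_fun setT (doubling : measurableTypeR R -> measurableTypeR R).
  have ml : measurable_fun setT (fun t : measurableTypeR R => 2 * t : R).
    exact: (measurable_funM (measurable_cst _) (@measurable_id _ _ _)).
  have mr : measurable_fun setT (fun t : measurableTypeR R => 2 * t - 1 : R).
    exact: (measurable_funB ml (measurable_cst _)).
  have mb : measurable_fun setT (fun t : measurableTypeR R => (t : R) < 2^-1).
    exact: (measurable_fun_ltr (@measurable_id _ _ _) (measurable_cst _)).
  exact: (measurable_fun_ifT mb ml mr).
have mi : measurable_fun setT
    (iter q doubling : measurableTypeR R -> measurableTypeR R).
  elim: q => [|q IH]; first exact: measurable_id.
  exact: (measurableT_comp md IH).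
have -> : [set t | digit q t] = iter q doubling @^-1` `[2^-1, +oo[%classic.
  by apply/seteqP; split => t; rewrite /digit /= in_itv /= andbT.
by rewrite -[X in measurable X]setTI; apply: mi.
Qed.

Variables (N : nat) (w : bool -> seq 'I_m).
Hypotheses (N0 : (0 < N)%N) (sw : forall b, size (w b) = N).

Let i0 : 'I_m := Ordinal (ltnW hm).

Definition concatenation t : shift_space hm :=
  fun n => nth i0 (w (digit (n %/ N) t)) (n %% N)%N.

Lemma concatenation_half_branch b t : 0 <= t < 1 ->
  concatenation (half_branch b t) = prepend (w b) (concatenation t).
Proof.
move=> t01; apply/funext => n; rewrite /concatenation /prepend sw.
case: ltnP => nN.
  rewrite divn_small // modn_small // digit0_half_branch //.
  by apply: set_nth_default; rewrite sw.
rewrite -{1 2}(subnK nN) divnDr ?dvdnn // divnn N0 addn1 modnDr.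
by rewrite digitS_half_branch.
Qed.

Lemma measurable_concatenation :
  measurable_fun setT (concatenation : measurableTypeR R -> X).
Proof.
apply: measurable_fun_cylinders => I.
have -> : concatenation @^-1` cylinder hm I =
    \bigcap_(k in [set k | (k < size I)%N])
      [set t | concatenation t k = nth i0 I k].
  by apply/seteqP; split => t /=; rewrite (cylinderP _ _ i0).
apply: bigcap_measurableType => k _.
rewrite /concatenation; set q := (k %/ N)%N; set r := (k %% N)%N.
pose P b := nth i0 (w b) r = nth i0 I k.
have -> : [set t | P (digit q t)] =
    ([set t | digit q t] `&` [set t | P true]) `|`
    (~` [set t | digit q t] `&` [set t | P false]).
  apply/seteqP; split => t /=; first by case: digit => ?; [left|right].
  by move=> [] [] + ?; case: digit.
have mc (Q : Prop) : measurable ([set _ | Q] : set (measurableTypeR R)).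
  have [q'|nq] := pselect Q.
    by rewrite (_ : [set _ | Q] = setT) //; apply/seteqP; split.
  by rewrite (_ : [set _ | Q] = set0) //; apply/seteqP; split.
apply: measurableU; apply: measurableI => //.
- exact: measurable_digit.
- by apply: measurableC; exact: measurable_digit.
Qed.

(** The law of an infinite concatenation of independent fair choices between
    the two words: the binary digits of a uniform number make the choices, and
    a half branch of the unit interval prepends a word. *)
Lemma exists_random_concatenation :
  exists nu : probability X R, self_similar w nu.
Proof.
have [nu nuE] := exists_pushforward_probability
  (@uniform01 R : probability (measurableTypeR R) R)
  (concatenation : measurableTypeR R -> X)
  measurable_concatenation.
exists nu => D mD; rewrite !nuE.
have mC : measurable (concatenation @^-1` D : set (measurableTypeR R)).
  by rewrite -[X in measurable X]setTI; exact: measurable_concatenation.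
apply: etrans (uniform01_half_branch _ mC) _.
suff E b : uniform01 (half_branch b @^-1` (concatenation @^-1` D)) =
    uniform01 (concatenation @^-1` (prepend (w b) @^-1` D)).
  by congr (_ * _ + _ * _)%E; exact: E.
rewrite /uniform01 /mrestr; congr lebesgue_measure.
apply/seteqP; split => t [/= + t01]; rewrite concatenation_half_branch //;
  by split.
Qed.

End concatenation.

(** * Self-similar laws of concatenations *)

Section self_similar.
Context {R : realType} {m : nat} {hm : (2 <= m)%N}.
Notation X := (borel (shift_space hm)).
Notation sigma := (@shift_map m hm).
Implicit Types (x y : shift_space hm) (I J : seq 'I_m).

Lemma iter_shift k x n : iter k sigma x n = x (n + k)%N.
Proof.
by elim: k n => [|k IH] n; rewrite ?addn0 // iterS /shift_map IH addSnnS.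
Qed.

Lemma prefix_word_iter k x n :
  prefix_word (iter k sigma x) n = drop k (prefix_word x (n + k)%N).
Proof.
apply: (@eq_from_nth _ (x 0%N));
  rewrite ?size_drop !size_mkseq ?addnK // => j jn.
rewrite nth_mkseq // nth_drop nth_mkseq; last by lia.
by rewrite iter_shift addnC.
Qed.

Lemma take_prefix_word k n x : (k <= n)%N ->
  take k (prefix_word x n) = prefix_word x k.
Proof.
by move=> kn; rewrite /prefix_word /mkseq -map_take take_iota (minn_idPl kn).
Qed.

Lemma cylinder_drop J x n : cylinder hm J x ->
  cylinder hm (drop n J) (iter n sigma x).
Proof.
move=> JE; rewrite /cylinder /= prefix_word_iter size_drop.
have [nJ|Jn] := leqP n (size J); first by rewrite subnK // JE.
by rewrite !drop_oversize ?size_mkseq //; lia.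
Qed.

Lemma prefix_prepend I x n :
  prefix_word (prepend I x) n = take n (I ++ prefix_word x n).
Proof.
apply: (@eq_from_nth _ (x 0%N)).
  by rewrite size_take size_cat !size_mkseq; case: ltnP => //; lia.
rewrite size_mkseq => j jn; rewrite nth_mkseq // nth_take // nth_cat /prepend.
by case: ltnP => // Ij; rewrite nth_mkseq //; lia.
Qed.

Lemma iter_shift_prepend I x : iter (size I) sigma (prepend I x) = x.
Proof.
apply/funext => n; rewrite iter_shift /prepend ltnNge leq_addl /=.
by rewrite addnK.
Qed.

Lemma prepend_cylinder I J : (size I <= size J)%N ->
  prepend I @^-1` cylinder hm J
  = if take (size I) J == I then cylinder hm (drop (size I) J) else set0.
Proof.
move=> IJ; apply/seteqP; split => x /= Jx.
  have tI : take (size I) J = I.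
    rewrite -Jx take_prefix_word // prefix_prepend.
    by rewrite take_cat ltnn subnn take0 cats0.
  rewrite tI eqxx -[x in cylinder _ _ x](iter_shift_prepend I).
  exact: cylinder_drop.
case: eqP Jx => // tI; rewrite /cylinder /= size_drop => Jx.
rewrite prefix_prepend take_cat ltnNge IJ /= take_prefix_word ?leq_subr //.
by rewrite Jx -{1}tI cat_take_drop.
Qed.

Lemma prepend_short_cylinder I J : (size J <= size I)%N ->
  prepend I @^-1` cylinder hm J = if take (size J) I == J then setT else set0.
Proof.
move=> JI; have E x : prefix_word (prepend I x) (size J) = take (size J) I.
  rewrite prefix_prepend take_cat; case: ltnP => // IJ.
  have e : size I = size J by apply/eqP; rewrite eqn_leq IJ.
  by rewrite -e subnn take0 cats0 take_size.
by apply/seteqP; split => x; rewrite /cylinder /= E; case: eqP.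
Qed.

Lemma measurable_iter_shift k : measurable_fun setT (iter k sigma : X -> X).
Proof.
elim: k => [|k IH]; first exact: measurable_id.
exact: (measurableT_comp measurable_shift_map IH).
Qed.

Lemma measurable_preimage d d' (Y : measurableType d) (Z : measurableType d')
    (f : Y -> Z) A :
  measurable_fun setT f -> measurable A -> measurable (f @^-1` A).
Proof. by move=> mf mA; rewrite -[_ @^-1` _]setTI; exact: mf. Qed.

Variables (N : nat) (w : bool -> seq 'I_m) (nu : probability X R).
Hypotheses (N0 : (0 < N)%N) (sw : forall b, size (w b) = N)
  (wd : w false <> w true).
Hypothesis nuE : self_similar w nu.

Lemma self_similar_iter_shift (A : set X) : measurable A ->
  nu (iter N sigma @^-1` A) = nu A.
Proof.
move=> mA; rewrite nuE; last first.
  exact: measurable_preimage (measurable_iter_shift N) mA.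
have E b : prepend (w b) @^-1` (iter N sigma @^-1` A) = A.
  by apply/seteqP; split => x; rewrite /preimage /= -(sw b) iter_shift_prepend.
rewrite !E -ge0_muleDl ?lee_fin ?invr_ge0 // -EFinD.
by rewrite (_ : 2^-1 + 2^-1 = 1) ?mul1e //; field.
Qed.

Lemma self_similar_ge b (D : set X) : measurable D ->
  ((2^-1)%:E * nu (prepend (w b) @^-1` D) <= nu D)%E.
Proof.
move=> mD; rewrite [leRHS]nuE //.
have h b' : (0 <= (2^-1)%:E * nu (prepend (w b') @^-1` D))%E.
  by rewrite mule_ge0 // lee_fin invr_ge0.
by case: b; [rewrite leeDr|rewrite leeDl].
Qed.

(** A cylinder whose word contains [q] complete blocks fixes [q] of the
    independent choices. *)
Lemma self_similar_cylinder_le J :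
  (nu (cylinder hm J) <= ((2^-1) ^+ (size J %/ N))%:E)%E.
Proof.
have [n] := ubnP (size J); elim: n J => // n IH J Jn.
have [JN|NJ] := ltnP (size J) N.
  by rewrite divn_small // expr0 probability_le1 //; exact: measurable_cylinder.
have hd b : (nu (prepend (w b) @^-1` cylinder hm J)
    <= if take N J == w b then ((2^-1) ^+ (size J %/ N).-1)%:E else 0)%E.
  rewrite prepend_cylinder ?sw //; case: eqP => _; last by rewrite measure0.
  apply: le_trans (IH _ _) _; rewrite size_drop; first by lia.
  by rewrite divnB ?divnn ?N0 // modnn ltn0 subn0 subn1.
have q0 : (0 < size J %/ N)%N by rewrite divn_gt0.
have h0 : (0 <= (2^-1 : R)%:E)%E by rewrite lee_fin invr_ge0.
rewrite nuE; last exact: measurable_cylinder.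
apply: le_trans (leeD (lee_wpmul2l h0 (hd false)) (lee_wpmul2l h0 (hd true))) _.
rewrite -[in leRHS](prednK q0) exprS EFinM.
by case: eqP => [->|_]; case: eqP => [e|_]; rewrite ?mule0 ?adde0 ?add0e //.
Qed.

(** Every block of [x], of length [N] and starting at a multiple of [N], is one
    of the two words. *)
Definition decodable x : Prop :=
  forall q, exists b, prefix_word (iter (q * N) sigma x) N = w b.

Lemma ae_decodable : {ae nu, forall x, decodable x}.
Proof.
apply: (@ae_foralln _ _ _ nu (fun q x => exists b,
  prefix_word (iter (q * N) sigma x) N = w b)) => q.
pose B := [set x : shift_space hm | ~ exists b, prefix_word x N = w b].
have mB : measurable (B : set X).
  exact: (measurable_prefix (fun I => ~ exists b, I = w b)).
exists (iter (q * N) sigma @^-1` B); split => //.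
  exact: measurable_preimage (measurable_iter_shift _) mB.
elim: q => [|q IH].
  apply: etrans (nuE _ mB) _.
  have E b : prepend (w b) @^-1` B = set0.
    apply/seteqP; split => // x; apply; exists b.
    by rewrite prefix_prepend take_cat sw ltnn subnn take0 cats0.
  by rewrite !E measure0 !mule0 adde0.
have -> : iter (q.+1 * N) sigma @^-1` B
    = iter N sigma @^-1` (iter (q * N) sigma @^-1` B).
  by apply/seteqP; split => x; rewrite /preimage /= mulSn addnC iterD.
apply: etrans IH; apply: self_similar_iter_shift.
exact: measurable_preimage (measurable_iter_shift _) mB.
Qed.

Lemma decodable_shift x : decodable x -> decodable (iter N sigma x).
Proof. by move=> h q; rewrite -iterD -mulSnr; exact: h. Qed.

(** A prefix of [n] letters touches at most [n %/ N + 1] blocks. *)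
Lemma decodable_cylinder_ge x n : decodable x ->
  (((2^-1) ^+ (n %/ N).+1)%:E <= nu (cylinder hm (prefix_word x n)))%E.
Proof.
have [k] := ubnP n; elim: k n x => // k IH n x nk dx.
have [b xb] := dx 0%N; rewrite mul0n /= in xb.
have mc : measurable (cylinder hm (prefix_word x n) : set X).
  exact: measurable_cylinder.
apply: le_trans (self_similar_ge b _ mc).
have [nN|Nn] := ltnP n N.
  rewrite prepend_short_cylinder ?size_mkseq ?sw 1?ltnW //.
  rewrite -xb take_prefix_word ?(ltnW nN) // eqxx probability_setT mule1.
  by rewrite divn_small // expr1.
rewrite prepend_cylinder ?size_mkseq ?sw // take_prefix_word // xb eqxx.
have -> : drop N (prefix_word x n) = prefix_word (iter N sigma x) (n - N).
  by rewrite prefix_word_iter subnK.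
rewrite exprS EFinM lee_wpmul2l ?lee_fin ?invr_ge0 //.
apply: le_trans (IH (n - N)%N _ _ (decodable_shift _ dx)); last by lia.
have q0 : (0 < n %/ N)%N by rewrite divn_gt0.
by rewrite divnB ?divnn ?N0 // modnn ltn0 subn0 subn1 prednK.
Qed.

(** Prepending words does not affect an invariant set, so by self-similarity it
    is independent of every cylinder, hence of itself. *)
Lemma self_similar_01 (A : set X) : measurable A -> iter N sigma @^-1` A = A ->
  nu A = 0%E \/ nu A = 1%E.
Proof.
move=> mA invA.
have gA b : prepend (w b) @^-1` A = A.
  rewrite -{1}invA; apply/seteqP; split => x;
    by rewrite /preimage /= -(sw b) iter_shift_prepend.
have indep J : nu (A `&` cylinder hm J) = (nu A * nu (cylinder hm J))%E.
  have [n] := ubnP (size J); elim: n J => // n IH J Jn.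
  have [->|J0] := eqVneq J [::].
    by rewrite cylinder_nil setIT probability_setT mule1.
  have mJ : measurable (cylinder hm J : set X) by exact: measurable_cylinder.
  have E b : nu (prepend (w b) @^-1` (A `&` cylinder hm J))
      = (nu A * nu (prepend (w b) @^-1` cylinder hm J))%E.
    rewrite preimage_setI gA.
    have [NJ|/ltnW JN] := leqP (size (w b)) (size J).
      rewrite prepend_cylinder //; case: ifP => _; last first.
        by rewrite setI0 measure0 mule0.
      apply: IH; rewrite size_drop sw; case: (J) J0 Jn => //= *; lia.
    rewrite prepend_short_cylinder //; case: ifP => _.
      by rewrite setIT probability_setT mule1.
    by rewrite setI0 measure0 mule0.
  rewrite nuE; last exact: measurableI.
  rewrite !E (nuE _ mJ).
  have fA : nu A \is a fin_num by rewrite fin_num_measure.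
  rewrite muleDr ?ge0_adde_def ?inE ?mule_ge0 ?lee_fin ?invr_ge0 //.
  by rewrite !(muleCA (nu A)).
have fA : nu A \is a fin_num by rewrite fin_num_measure.
have f0 : 0 <= fine (nu A) by rewrite fine_ge0.
have h : nu (A `&` A) = (nu A * nu A)%E.
  have fin : (mrestr nu mA setT < +oo)%E.
    by rewrite /mrestr setTI ltey_eq fA.
  have eqA := measure_eq_cylinders (mrestr nu mA) (mscale (NngNum f0) nu) fin.
  have E (B : set X) : mscale (NngNum f0) nu B = (nu A * nu B)%E.
    by rewrite /mscale /= fineK.
  apply: etrans (eqA _ A mA) (E A) => J; apply: etrans (esym (E _)).
  by rewrite -indep setIC.
move: h; rewrite setIid -(fineK fA) -EFinM => -[] /eqP.
rewrite -subr_eq0 -{1}[fine _]mulr1 -mulrBr mulf_eq0 subr_eq0.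
by move=> /orP[/eqP ->|/eqP <-]; [left|right].
Qed.

End self_similar.

(** * The shift-invariant average over the phases *)

Section average.
Context {d} {T : measurableType d} {R : realType}.

Lemma exists_average (n : nat) (P : nat -> probability T R) : (0 < n)%N ->
  exists mu : probability T R,
    forall A, mu A = ((n%:R^-1)%:E * \sum_(k < n) P k A)%E.
Proof.
move=> n0; have h : 0 <= n%:R^-1 :> R by rewrite invr_ge0.
pose mu0 := mscale (NngNum h) (msum P n).
have muT : mu0 setT = 1%E.
  rewrite /mu0 /mscale /= /msum (eq_bigr (fun=> 1%E)) => [|k _].
    rewrite sumEFin sumr_const card_ord -EFinM mulVf // pnatr_eq0; lia.
  exact: probability_setT.
pose mu : probability T R :=
  HB.pack mu0 (Measure_isProbability.Build _ _ _ mu0 muT).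
by exists mu.
Qed.

End average.

Section phase_average.
Context {R : realType} {m : nat} {hm : (2 <= m)%N}.
Notation X := (borel (shift_space hm)).
Notation sigma := (@shift_map m hm).
Implicit Types (x y : shift_space hm) (I J : seq 'I_m).
Variables (N : nat) (w : bool -> seq 'I_m) (nu mu : probability X R).
Hypotheses (N0 : (0 < N)%N) (sw : forall b, size (w b) = N)
  (wd : w false <> w true).
Hypothesis nuE : self_similar w nu.
Hypothesis muE : forall A : set X, measurable A ->
  mu A = ((N%:R^-1)%:E * \sum_(k < N) nu (iter k sigma @^-1` A))%E.

Let N1 : 0 < N%:R :> R. Proof. by rewrite ltr0n. Qed.

Let averagen (a : R) : N%:R^-1 * (a *+ N) = a.
Proof. by rewrite -[a *+ N]mulr_natr mulrC mulfK // gt_eqF. Qed.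

Lemma average_invariant : invariant_measure mu sigma.
Proof.
move=> A mA.
have mA' : measurable (sigma @^-1` A : set X).
  exact: measurable_preimage measurable_shift_map mA.
rewrite !muE //; congr (_ * _)%E.
have E k : iter k sigma @^-1` (sigma @^-1` A) = iter k.+1 sigma @^-1` A by [].
under eq_bigr do rewrite E.
have := self_similar_iter_shift N w nu sw nuE A mA.
case: (N) N0 => // n _ h.
by rewrite big_ord_recr big_ord_recl /= addeC h.
Qed.

Lemma average_ergodic : ergodic_measure mu sigma.
Proof.
split=> [|A mA invA]; first exact: average_invariant.
have itA k : iter k sigma @^-1` A = A.
  elim: k => // k IH; rewrite -{2}IH -{2}invA.
  by apply/seteqP; split => x; rewrite /preimage /= ?iterSr // -iterSr.
have -> : mu A = nu A.
  rewrite muE // (eq_bigr (fun=> nu A)) => [|k _]; last by rewrite itA.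
  rewrite -(fineK (_ : nu A \is a fin_num)) ?fin_num_measure //.
  by rewrite sumEFin sumr_const card_ord -EFinM averagen.
exact: (self_similar_01 N w nu N0 sw nuE A mA (itA N)).
Qed.

Lemma average_ge k (A : set X) : measurable A -> (k < N)%N ->
  ((N%:R^-1)%:E * nu (iter k sigma @^-1` A) <= mu A)%E.
Proof.
move=> mA kN; rewrite muE // lee_wpmul2l ?lee_fin ?invr_ge0 //.
by rewrite (bigD1 (Ordinal kN)) //= leeDl // sume_ge0.
Qed.

(** Each phase carries a fixed proportion of the average, so an almost sure
    property of the average also holds almost surely in that phase. *)
Lemma ae_average k (P : X -> Prop) : (k < N)%N ->
  {ae mu, forall x, P x} -> {ae nu, forall x, P (iter k sigma x)}.
Proof.
move=> kN [B [mB B0 PB]]; exists (iter k sigma @^-1` B); split.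
- exact: measurable_preimage (measurable_iter_shift k) mB.
- apply/eqP; rewrite eq_le measure_ge0 andbT.
  have := average_ge k B mB kN; rewrite [mu B]B0.
  by rewrite pmule_rle0 // lte_fin invr_gt0.
- by move=> x nPx; apply: PB.
Qed.

(** Whatever the phase, at most two of the blocks that meet a cylinder are
    incomplete. *)
Lemma average_cylinder_le J :
  (mu (cylinder hm J) <= ((2^-1) ^+ (size J %/ N).-1)%:E)%E.
Proof.
have mc I : measurable (cylinder hm I : set X) by exact: measurable_cylinder.
rewrite muE //.
have h k : (k < N)%N -> (nu (iter k sigma @^-1` cylinder hm J)
    <= ((2^-1) ^+ (size J %/ N).-1)%:E)%E.
  move=> kN.
  have mi j I : measurable (iter j sigma @^-1` cylinder hm I : set X).
    exact: measurable_preimage (measurable_iter_shift j) (mc I).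
  (* forget the incomplete first block *)
  apply: (@le_trans _ _ (nu (iter N sigma @^-1` cylinder hm (drop (N - k) J)))).
    apply: le_measure; rewrite ?inE // => x /= Jx.
    have := cylinder_drop _ _ (N - k) Jx; by rewrite -iterD subnK // ltnW.
  rewrite (self_similar_iter_shift N w nu sw nuE) //.
  apply: le_trans (self_similar_cylinder_le N w nu N0 sw wd nuE _) _.
  rewrite lee_fin size_drop ler_wiXn2l ?invr_ge0 ?invf_le1 ?ler1n //.
  apply: leq_trans (leq_div2r N (leq_sub2l (size J) (leq_subr k N))).
  by rewrite divnB // divnn N0 modnn ltn0 subn0 subn1.
apply: (@le_trans _ _ ((N%:R^-1)%:E *
    \sum_(k < N) ((2^-1) ^+ (size J %/ N).-1)%:E)%E).
  rewrite lee_wpmul2l ?lee_fin ?invr_ge0 //.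
  by apply: lee_sum => k _; exact: h.
by rewrite sumEFin sumr_const card_ord -EFinM averagen.
Qed.

Lemma average_cylinder_ge k y n : decodable N w y -> (k < N)%N ->
  ((N%:R^-1 * (2^-1) ^+ (n %/ N).+2)%:E
    <= mu (cylinder hm (prefix_word (iter k sigma y) n)))%E.
Proof.
move=> dy kN.
have mc I : measurable (cylinder hm I : set X) by exact: measurable_cylinder.
apply: le_trans (average_ge k _ (mc _) kN).
rewrite EFinM lee_wpmul2l ?lee_fin ?invr_ge0 //.
apply: (@le_trans _ _ (nu (cylinder hm (prefix_word y (n + k)%N)))).
  apply: le_trans (decodable_cylinder_ge N w nu N0 sw nuE _ _ dy).
  rewrite lee_fin ler_wiXn2l ?invr_ge0 ?invf_le1 ?ler1n // ltnS.
  apply: leq_trans (leq_div2r N (_ : _ <= n + N)%N) _.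
    by rewrite leq_add2l ltnW.
  by rewrite divnDr // divnn N0 addn1.
apply: le_measure; rewrite ?inE //.
  exact: measurable_preimage (measurable_iter_shift k) (mc _).
move=> x Jx; have := cylinder_drop _ _ k Jx.
by rewrite -prefix_word_iter.
Qed.

(** Along the orbit of a decodable point the information grows at the rate of
    one bit per block. *)
Lemma info_average k y n : decodable N w y -> (k < N)%N ->
  `|info mu (prefix_word (iter k sigma y) n) - n%:R * (ln 2 / N%:R)|
    <= ln N%:R + 2 * ln 2.
Proof.
move=> dy kN; set J := prefix_word _ _.
have := average_cylinder_ge k y n dy kN; rewrite -/J.
have := average_cylinder_le J; rewrite size_mkseq.
rewrite fine_cylinder !lee_fin /info; set a := fine _.
set q := (n %/ N)%N => up lo.
have l2 : 0 < ln (2 : R) by rewrite ln_gt0 // ltr1n.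
have lN : 0 <= ln (N%:R : R) by rewrite ln_ge0 // ler1n.
have P0 j : 0 < (2^-1 : R) ^+ j by rewrite exprn_gt0 // invr_gt0.
have lP j : ln ((2^-1 : R) ^+ j) = - (j%:R * ln 2).
  by rewrite lnXn ?invr_gt0 // lnV ?posrE // mulNrn mulr_natl.
have lo0 : 0 < N%:R^-1 * (2^-1 : R) ^+ q.+2 by rewrite mulr_gt0 ?invr_gt0.
have a0 : 0 < a by exact: lt_le_trans lo.
have {}up : ln a <= - (q.-1%:R * ln 2) by rewrite -lP ler_ln ?posrE.
have {}lo : - ln N%:R - q.+2%:R * ln 2 <= ln a.
  rewrite -lP -lnV ?posrE // -lnM ?posrE ?invr_gt0 // ler_ln ?posrE //.
have q1 : n%:R / N%:R - 2 <= q.-1%:R :> R.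
  rewrite lerBlDr ler_pdivrMr // -natrD -natrM ler_nat.
  apply: leq_trans (ltnW (ltn_ceil n N0)) _.
  by rewrite leq_mul2r; apply/orP; right; rewrite -/q; lia.
have q2 : q%:R <= n%:R / N%:R :> R.
  by rewrite ler_pdivlMr // -natrM ler_nat leq_divM.
have h1 := ler_wpM2r (ltW l2) q1; have h2 := ler_wpM2r (ltW l2) q2.
move: lo; rewrite -addn2 natrD => lo.
rewrite ler_norml mulrA [_ * ln 2 / _]mulrAC.
move: h1 h2 lo up; rewrite !mulrDl !mulNr.
move: (q%:R * ln 2) (q.-1%:R * ln 2) (n%:R / N%:R * ln 2) => A B C.
by move=> *; apply/andP; split; lra.
Qed.

End phase_average.

(** * Two different exponents when the ratios differ *)

Section block_growth.
Context {R : realType} {m : nat} {hm : (2 <= m)%N}.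
Notation X := (borel (shift_space hm)).
Notation sigma := (@shift_map m hm).
Implicit Types (x y : shift_space hm) (I J : seq 'I_m) (c d : 'I_m -> R).

Lemma prefix_word_cat x k n :
  prefix_word x (k + n)%N = prefix_word x k ++ prefix_word (iter k sigma x) n.
Proof.
rewrite -[LHS](cat_take_drop k) take_prefix_word ?leq_addr //.
by rewrite prefix_word_iter addnC.
Qed.

Lemma ln_altprod_itv c d I (M : R) :
  (forall i, 0 < `|c i| < 1) -> (forall i, 0 < `|d i| < 1) ->
  (forall i, - ln `|c i| <= M) -> (forall i, - ln `|d i| <= M) ->
  0 <= - ln (altprod c d I) <= (size I)%:R * M.
Proof.
elim: I c d => [|i I IH] c d hc hd cM dM /=.
  by rewrite ln1 oppr0 mul0r lexx.
have /andP[h1 h2] := IH d c hd hc dM cM.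
have hc0 j : 0 < `|c j| by case/andP: (hc j).
have hd0 j : 0 < `|d j| by case/andP: (hd j).
rewrite lnM ?posrE ?altprod_gt0 //.
have l0 := ln_lt0 (hc i); have l1 := cM i.
by rewrite -[(size I).+1%:R]natr1 mulrDl mul1r; apply/andP; split; lra.
Qed.

Variables (N : nat) (w : bool -> seq 'I_m).
Hypotheses (N0 : (0 < N)%N) (sw : forall b, size (w b) = N) (Neven : ~~ odd N).

(** Blocks of even length preserve the parity that decides which of the two
    entries each letter contributes. *)
Lemma ln_altprod_decodable c d (Q M : R) y n :
  (forall i, 0 < `|c i| < 1) -> (forall i, 0 < `|d i| < 1) ->
  (forall i, - ln `|c i| <= M) -> (forall i, - ln `|d i| <= M) ->
  (forall b, altprod c d (w b) = Q) -> decodable N w y ->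
  `|- ln (altprod c d (prefix_word y n)) - n%:R * (- ln Q / N%:R)| <= N%:R * M.
Proof.
move=> hc hd cM dM wQ dy.
have hc0 j : 0 < `|c j| by case/andP: (hc j).
have hd0 j : 0 < `|d j| by case/andP: (hd j).
have NR : 0 < N%:R :> R by rewrite ltr0n.
have Q0 : 0 < Q by rewrite -(wQ true) altprod_gt0.
have altq q (z : shift_space hm) : decodable N w z ->
    altprod c d (prefix_word z (q * N)%N) = Q ^+ q.
  elim: q z => [|q IH] z dz; first by rewrite mul0n expr0.
  have [b zb] := dz 0%N; rewrite mul0n /= in zb.
  rewrite mulSn prefix_word_cat zb altprod_cat sw (negbTE Neven) wQ exprS.
  by rewrite IH //; exact: decodable_shift.
have oddqN q : odd (q * N) = false by rewrite oddM (negbTE Neven) andbF.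
set q := (n %/ N)%N; set r := (n %% N)%N.
have nE : n = (q * N + r)%N by exact: divn_eq.
have rN : (r < N)%N by rewrite ltn_mod.
rewrite {1}nE prefix_word_cat altprod_cat size_mkseq oddqN altq //.
set I := prefix_word _ r.
have := ln_altprod_itv c d I M hc hd cM dM; rewrite size_mkseq.
have := ln_altprod_itv c d (w true) M hc hd cM dM; rewrite sw wQ.
have M0 : 0 <= M.
  apply: le_trans (cM ((y : shift_space hm) 0%N)).
  by rewrite oppr_ge0 ltW ?ln_lt0.
have rNM : r%:R * M <= N%:R * M by rewrite ler_wpM2r // ler_nat ltnW.
have rb0 : 0 <= - ln Q -> 0 <= r%:R * (- ln Q / N%:R) <= - ln Q.
  move=> lQ; rewrite mulr_ge0 ?divr_ge0 ?(ltW NR) //=.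
  by rewrite mulrCA ler_piMr // ler_pdivrMr // mul1r ler_nat ltnW.
have E : n%:R * (- ln Q / N%:R) = q%:R * - ln Q + r%:R * (- ln Q / N%:R).
  rewrite {1}nE natrD natrM mulrDl -mulrA (mulrC N%:R) divfK //.
  by rewrite gt_eqF.
rewrite lnM ?posrE ?exprn_gt0 ?altprod_gt0 // lnXn // -[ln Q *+ q]mulr_natl E.
move=> /andP[h1 h2] /andP[h3 h4]; have /andP[h5 h6] := rb0 h1.
by rewrite ler_norml; apply/andP; split; lra.
Qed.

(** Deleting the first letter exchanges the roles of [c] and [d], so in the odd
    phase the other product of the blocks sets the rate. *)
Lemma ln_altprod_shift_decodable c d (Q M : R) y n :
  (forall i, 0 < `|c i| < 1) -> (forall i, 0 < `|d i| < 1) ->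
  (forall i, - ln `|c i| <= M) -> (forall i, - ln `|d i| <= M) ->
  (forall b, altprod d c (w b) = Q) -> decodable N w y ->
  `|- ln (altprod c d (prefix_word (sigma y) n)) - n%:R * (- ln Q / N%:R)|
     <= (N%:R + 2) * M.
Proof.
move=> hc hd cM dM wQ dy.
have hc0 j : 0 < `|c j| by case/andP: (hc j).
have hd0 j : 0 < `|d j| by case/andP: (hd j).
have NR : 0 < N%:R :> R by rewrite ltr0n.
have := ln_altprod_decodable d c Q M y n.+1 hd hc dM cM wQ dy.
rewrite prefix_wordS /= lnM ?posrE ?altprod_gt0 //.
have := dM ((y : shift_space hm) 0%N).
have := ln_lt0 (hd ((y : shift_space hm) 0%N)).
have : 0 <= - ln Q / N%:R <= M.
  have /andP[h1 h2] := ln_altprod_itv d c (w true) M hd hc dM cM.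
  rewrite wQ sw in h1 h2.
  by rewrite divr_ge0 ?(ltW NR) //= ler_pdivrMr // mulrC.
rewrite -[n.+1%:R]natr1 [(_ + 1) * _]mulrDl mul1r [(_ + 2) * M]mulrDl.
rewrite !ler_norml => /andP[? ?] ? ? /andP[? ?].
by apply/andP; split; lra.
Qed.

Variable mu : probability X R.

(** For the first axis the projected norm is the first alternating product. *)
Lemma S_lim_axis c d x (h b C : R) :
  (forall i, 0 < `|c i| < 1) -> (forall i, 0 < `|d i| < 1) ->
  0 <= h < b -> (forall n, (0 < mu (cylinder hm (prefix_word x n)))%E) ->
  (forall n, `|info mu (prefix_word x n) - n%:R * h| <= C) ->
  (forall n, `|- ln (altprod c d (prefix_word x n)) - n%:R * b| <= C) ->
  S_lim mu (fun i => antidiag_mx (c i) (d i)) <[delta_mx 0%R 0%R]>%VS x = h / b.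
Proof.
move=> hc hd /andP[h0 hb] mu0 hi ha.
have u0 : (delta_mx 0 0 : 'cV[R]_2) != 0.
  by apply/eqP => /matrixP /(_ 0 0); rewrite !mxE => /eqP; rewrite oner_eq0.
apply/cvg_lim => //; have := cvg_clipped_ratio _ _ _ _ _ h0 hb hi ha.
apply: cvg_trans; apply: near_eq_cvg; exists 1%N => // n /= n0.
rewrite S_n_projnorm // /projnorm /normsq !mxE /= expr1n expr0n addr0 divr1.
rewrite subrr mul0r addr0 mul1r sqrtr_sqr ger0_norm // ltW //.
by apply: altprod_gt0 => i; [case/andP: (hc i)|case/andP: (hd i)].
Qed.

End block_growth.

Section non_constant_exponents.
Context {R : realType} {m : nat} {hm : (2 <= m)%N}.
Notation X := (borel (shift_space hm)).
Notation sigma := (@shift_map m hm).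
Implicit Types (c d : 'I_m -> R) (i j : 'I_m).

(** The exponent is [ln 2 / - ln Q] at decodable points and [ln 2 / - ln Q'] at
    their shifts, and both kinds of points have mass at least [1 / N]. The
    bound [1 / 2] on [Q] and [Q'] keeps both values below the cut-off at 1. *)
Lemma exists_ergodic_gap c d (N : nat) (w : bool -> seq 'I_m) (Q Q' : R) :
  (forall i, 0 < `|c i| < 1) -> (forall i, 0 < `|d i| < 1) ->
  (1 < N)%N -> ~~ odd N -> (forall b, size (w b) = N) -> w false <> w true ->
  (forall b, altprod c d (w b) = Q) -> (forall b, altprod d c (w b) = Q') ->
  Q < 2^-1 -> Q' < 2^-1 -> Q <> Q' ->
  exists (mu : probability X R) (W : {vspace 'cV[R]_2}),
    ergodic_measure mu sigma /\ \dim W = 1%N /\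
    S_upper mu (fun i => antidiag_mx (c i) (d i)) W
    <> S_lower mu (fun i => antidiag_mx (c i) (d i)) W.
Proof.
move=> hc hd N1 Neven sw wd wQ wQ' Q2 Q'2 QQ'.
have N0 : (0 < N)%N by exact: ltnW.
have hc0 i : 0 < `|c i| by case/andP: (hc i).
have hd0 i : 0 < `|d i| by case/andP: (hd i).
have Q0 : 0 < Q by rewrite -(wQ true) altprod_gt0.
have Q'0 : 0 < Q' by rewrite -(wQ' true) altprod_gt0.
have [nu nuE] := @exists_random_concatenation R m hm N w N0 sw.
have [mu muE] := exists_average N (fun k => sval (cid
  (exists_pushforward_probability nu (iter k sigma : X -> X)
    (measurable_iter_shift k)))) N0.
have {}muE (A : set X) : measurable A ->
    mu A = ((N%:R^-1)%:E * \sum_(k < N) nu (iter k sigma @^-1` A))%E.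
  move=> mA; rewrite muE; congr (_ * _)%E; apply: eq_bigr => k _.
  by case: cid.
exists mu, <[delta_mx 0%R 0%R]>%VS; split.
  exact: (average_ergodic N w nu mu N0 sw nuE muE).
split.
  rewrite dim_vline; case: eqP => // /matrixP /(_ 0 0).
  by rewrite !mxE => /eqP; rewrite oner_eq0.
set T := fun i => _; set W := <[_]>%VS => SS.
have cst : {ae mu, forall x, (S_lim mu T W x)%:E = S_upper mu T W}.
  have up := ess_sup_ge mu (EFin \o S_lim mu T W).
  have lo := ess_inf_le mu (EFin \o S_lim mu T W).
  apply: filterS2 up lo => x /= ux lx; apply/le_anti; rewrite ux /=.
  by rewrite SS.
have cst0 := ae_average N nu mu N0 muE 0 _ N0 cst.
have cst1 := ae_average N nu mu N0 muE 1 _ N1 cst.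
have good : {ae nu, forall y : X,
    [/\ (S_lim mu T W (y : shift_space hm))%:E = S_upper mu T W,
      (S_lim mu T W (sigma (y : shift_space hm)))%:E = S_upper mu T W
    & decodable N w (y : shift_space hm)]}.
  have dec := ae_decodable N w nu sw nuE.
  apply: (@filterS3 _ (almost_everywhere nu) _ _ _ _ _ _ cst0 cst1 dec) => y.
  exact: And3.
have [y [e0 e1 dy]] := ae_exists nu _ good.
pose M : R := \sum_i (- ln `|c i|) + \sum_i (- ln `|d i|).
have pos (f : 'I_m -> R) : (forall i, 0 < `|f i| < 1) -> forall i,
    0 <= - ln `|f i| <= \sum_i (- ln `|f i|).
  move=> hf i; have f0 k : 0 <= - ln `|f k| by rewrite oppr_ge0 ltW ?ln_lt0.
  by rewrite f0 (bigD1 i) //= lerDl sumr_ge0.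
pose i0 : 'I_m := Ordinal (ltnW hm).
have cM i : - ln `|c i| <= M.
  have /andP[? ?] := pos _ hc i; have /andP[? ?] := pos _ hd i; rewrite /M; lra.
have dM i : - ln `|d i| <= M.
  have /andP[? ?] := pos _ hc i; have /andP[? ?] := pos _ hd i; rewrite /M; lra.
have M0 : 0 <= M by apply: le_trans (cM i0); case/andP: (pos _ hc i0).
have NR : 0 < N%:R :> R by rewrite ltr0n.
have l2 : 0 < ln (2 : R) by rewrite ln_gt0 // ltr1n.
have rate (q : R) : 0 < q -> q < 2^-1 -> 0 <= (ln 2 : R) / N%:R < - ln q / N%:R.
  move=> q0 q2; rewrite divr_ge0 ?(ltW l2) ?(ltW NR) //=.
  by rewrite ltr_pM2r ?invr_gt0 // ltrNr -lnV ?posrE // ltr_ln ?posrE ?invr_gt0.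
have mupos k n : (k < N)%N ->
    (0 < mu (cylinder hm (prefix_word (iter k sigma y) n)))%E.
  move=> kN; apply: lt_le_trans
    (average_cylinder_ge N w nu mu N0 sw nuE muE k _ n dy kN).
  by rewrite lte_fin mulr_gt0 ?invr_gt0 // exprn_gt0 ?invr_gt0.
pose C : R := ln N%:R + 2 * ln 2 + (N%:R + 2) * M.
have C1 : ln N%:R + 2 * ln 2 <= C.
  by rewrite /C lerDl mulr_ge0 // addr_ge0 // ltW.
have C2 : (N%:R + 2) * M <= C.
  rewrite /C lerDr addr_ge0 // ?mulr_ge0 // ?(ltW l2) // ln_ge0 //.
  by rewrite ler1n.
have C3 : N%:R * M <= C.
  by apply: le_trans C2; rewrite ler_wpM2r // lerDl.
have info_bound k n kN := info_average N w nu mu N0 sw wd nuE muE k y n dy kN.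
have v0 : S_lim mu T W y = (ln 2 / N%:R) / (- ln Q / N%:R).
  apply: (S_lim_axis mu c d y _ _ C hc hd (rate _ Q0 Q2)) => n.
  - exact: (mupos 0%N).
  - exact: le_trans (info_bound 0%N n N0) C1.
  - apply: le_trans C3.
    exact: (ln_altprod_decodable N w N0 sw Neven).
have v1 : S_lim mu T W (sigma y) = (ln 2 / N%:R) / (- ln Q' / N%:R).
  apply: (S_lim_axis mu c d (sigma y) _ _ C hc hd (rate _ Q'0 Q'2)) => n.
  - exact: (mupos 1%N).
  - exact: le_trans (info_bound 1%N n N1) C1.
  - apply: le_trans C2.
    exact: (ln_altprod_shift_decodable N w N0 sw Neven).
have h0 : ln 2 / N%:R != 0 :> R by rewrite mulf_neq0 ?invr_eq0 ?gt_eqF.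
rewrite v0 in e0; rewrite v1 in e1.
have /(mulfI h0)/invr_inj/(mulIf _) E := EFin_inj (etrans e0 (esym e1)).
apply/QQ'/ln_inj; rewrite ?posrE //; apply: oppr_inj; apply: E.
by rewrite invr_eq0 gt_eqF.
Qed.

End non_constant_exponents.

Section words.
Context {R : realType} {m : nat}.
Implicit Types (c d : 'I_m -> R) (i j : 'I_m).

Definition alternate i j L (I : seq 'I_m) := iter L (fun J => i :: j :: J) I.

Lemma size_alternate i j L I : size (alternate i j L I) = (L.*2 + size I)%N.
Proof. by elim: L => //= L ->; lia. Qed.

Lemma altprod_alternate c d i j L I :
  altprod c d (alternate i j L I) = (`|c i| * `|d j|) ^+ L * altprod c d I.
Proof.
by elim: L => [|L IH] /=; rewrite ?expr0 ?mul1r // IH exprS !mulrA.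
Qed.

Lemma alternate_inj i j L : injective (alternate i j L).
Proof. by elim: L => [|L IH] I J //= [] /IH. Qed.

(** The prefix [i j i j ...] separates the two products, while the endings
    [i j j i] and [j j i i] distinguish the words without changing either
    product, since each letter occurs once at an even and once at an odd
    position. A long prefix makes both products small. *)
Lemma exists_words c d i j :
  (forall i, 0 < `|c i| < 1) -> (forall i, 0 < `|d i| < 1) ->
  `|c i / d i| <> `|c j / d j| ->
  exists (N : nat) (w : bool -> seq 'I_m) (Q Q' : R),
    [/\ (1 < N)%N, ~~ odd N, forall b, size (w b) = N & w false <> w true] /\
    [/\ forall b, altprod c d (w b) = Q, forall b, altprod d c (w b) = Q',
      Q < 2^-1, Q' < 2^-1 & Q <> Q'].
Proof.
move=> hc hd cd.
have hc0 k : 0 < `|c k| by case/andP: (hc k).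
have hd0 k : 0 < `|d k| by case/andP: (hd k).
have [rho [/andP[r0 r1] hcr hdr]] := exists_contraction c d hc hd.
have hcr1 k : `|c k| <= rho by case/andP: (hcr k).
have hdr1 k : `|d k| <= rho by case/andP: (hdr k).
have [L rL L0] : exists2 L, rho ^+ L < 2^-1 & (0 < L)%N.
  have : rho ^+ n @[n --> \oo] --> (0 : R).
    by apply: cvg_expr; rewrite ger0_norm ?ltW.
  have half0 : 0 < 2^-1 :> R by rewrite invr_gt0.
  move/(cvgr_lt 0) => /(_ _ half0) [L _ hL].
  exists L.+1 => //; exact: (hL L.+1 (leqnSn L)).
pose w b := alternate i j L (if b then [:: j; j; i; i] else [:: i; j; j; i]).
have ij : i <> j by move=> e; apply: cd; rewrite e.
have small (f g : 'I_m -> R) : (forall k, `|f k| <= rho) ->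
    (forall k, `|g k| <= rho) -> altprod f g (w true) < 2^-1.
  move=> hf hg; apply: le_lt_trans (altprod_le _ _ _ _ hf hg) _.
  apply: le_lt_trans rL; rewrite ler_wiXn2l ?(ltW r0) ?(ltW r1) //.
  by rewrite size_alternate; lia.
exists (L.*2 + 4)%N, w, (altprod c d (w true)), (altprod d c (w true)).
split; split.
- by lia.
- by rewrite oddD odd_double.
- by move=> b; rewrite size_alternate; case: b.
- by move=> /alternate_inj [].
- by case; rewrite // /w !altprod_alternate /=; ring.
- by case; rewrite // /w !altprod_alternate /=; ring.
- exact: small.
- exact: small.
have [dn0i dn0j] : `|d i| != 0 /\ `|d j| != 0 by rewrite !gt_eqF.
rewrite /w !altprod_alternate /= => E; apply: cd; rewrite !normrM !normfV.
have K0 : `|c j| * (`|d j| * (`|c i| * (`|d i| * 1))) != 0.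
  by rewrite !mulf_neq0 ?gt_eqF // oner_eq0.
have {}E : (`|c i| * `|d j|) ^+ L = (`|d i| * `|c j|) ^+ L.
  by apply: (mulIf K0); rewrite E; ring.
have /eqP : (`|c i| * `|d j|) ^+ L == (`|d i| * `|c j|) ^+ L by rewrite E.
move=> /eqP; rewrite eqrXn2 ?mulr_ge0 // => /eqP e.
apply: (mulIf dn0i); rewrite divfK //; apply: (mulIf dn0j).
by rewrite e; field.
Qed.

End words.

Theorem proposition8p3 (R : realType) (m : nat) (hm : (2 <= m)%N)
    (c d : 'I_m -> R) (T : 'I_m -> 'M[R]_2)
    (hT : forall i, T i = antidiag_mx (c i) (d i))
    (hc : forall i, 0 < `|c i| < 1) (hd : forall i, 0 < `|d i| < 1) :
  (exists i j : 'I_m, i <> j /\ `|c i / d i| <> `|c j / d j|)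
  <->
  (exists (mu : probability (borel (shift_space hm)) R)
          (W : {vspace 'cV[R]_2}),
     ergodic_measure mu (@shift_map m hm) /\ \dim W = 1%N /\
     S_upper mu T W <> S_lower mu T W).
Proof.
have -> : T = fun i => antidiag_mx (c i) (d i) by apply/funext.
split=> [[i [j [_ cd]]]|[mu [W [erg [dW SS]]]]].
  have [N [w [Q [Q' [[N1 Neven sw wd] [wQ wQ' Q2 Q'2 QQ']]]]]] :=
    exists_words c d i j hc hd cd.
  exact: (exists_ergodic_gap c d N w Q Q').
apply: contrapT => nex; apply: SS.
pose i0 : 'I_m := Ordinal (ltnW hm).
have d0 i : 0 < `|d i| by case/andP: (hd i).
have r0 : 0 < `|c i0 / d i0|.
  by rewrite normrM normfV divr_gt0 //; case/andP: (hc i0).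
apply: (S_upper_lower_eq mu erg.1 c d `|c i0 / d i0|) => // i.
have -> : `|c i0 / d i0| = `|c i / d i|.
  have [->//|ii0] := eqVneq i i0; apply: contrapT => ne; apply: nex.
  by exists i0, i; split => //; apply/eqP; rewrite eq_sym.
by rewrite normrM normfV divfK // gt_eqF.
Qed.
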